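(* Let $\mathcal P(\boldsymbol\alpha,\boldsymbol\ell)$ be a curvilinear polygon with quasi-eigenvalues $\sigma_1\le\sigma_2\le\dots$, and let $\nu_1\le\nu_2\le\dots$ be the eigenvalues of the quantum graph Laplacian $\Delta_{\mathcal G}$, both listed non-decreasingly with multiplicities. Then $\sigma_m^2=\nu_m$ for all $m\ge1$.
   Context: A curvilinear polygon $\mathcal P(\boldsymbol\alpha,\boldsymbol\ell)$: bounded simply connected planar domain bounded by $n$ smooth arcs $I_j$ of lengths $\ell_j>0$, vertices $V_1,\dots,V_n$ clockwise (cyclic indices), $I_j$ joins $V_{j-1}$ to $V_j$, interior angle $\alpha_j\in(0,\pi)$ at $V_j$. Quantum graph: $\mathcal G(\boldsymbol\ell)$ is the cyclic metric graph with vertices $V_1,\dots,V_n$ and edges $I_j$ (joining $V_{j-1},V_j$) of lengths $\ell_j$, with arc-length coordinate $s$ increasing from $V_{j-1}$ to $V_j$ along each $I_j$. For a function $g$ on $\mathcal G$, $g|_{V_j-0}$ and $g|_{V_j+0}$ denote the limits at $V_j$ along $I_j$ and along $I_{j+1}$ respectively. $\Delta_{\mathcal G}$ is the operator $f\mapsto -f''$ on $\bigoplus_j H^2(I_j)$ with matching conditions at each $V_j$: $\sin(\frac{\pi^2}{4\alpha_j})f|_{V_j+0}=\cos(\frac{\pi^2}{4\alpha_j})f|_{V_j-0}$ and $\cos(\frac{\pi^2}{4\alpha_j})f'|_{V_j+0}=\sin(\frac{\pi^2}{4\alpha_j})f'|_{V_j-0}$; it is self-adjoint, non-negative, with discrete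 spectrum. Equivalently its eigenvalues are the min-max values of $\sum_j\int_{I_j}|f'|^2$ over $\sum_j\int_{I_j}|f|^2$ on the form domain $\{f\in\bigoplus_jH^1(I_j):\sin(\frac{\pi^2}{4\alpha_j})f|_{V_j+0}=\cos(\frac{\pi^2}{4\alpha_j})f|_{V_j-0}\ \forall j\}$. Quasi-eigenvalues: $\mathcal E=\{\pi/(2k)\}$, $\mathcal O(\pi/(2k))=(-1)^k$. For $\alpha\notin\mathcal E$, $\mathtt A(\alpha)=\begin{pmatrix}\csc\frac{\pi^2}{2\alpha}&-i\cot\frac{\pi^2}{2\alpha}\\ i\cot\frac{\pi^2}{2\alpha}&\csc\frac{\pi^2}{2\alpha}\end{pmatrix}$, $\mathtt B(\ell,\sigma)=\operatorname{diag}(e^{i\ell\sigma},e^{-i\ell\sigma})$. If no $\alpha_j\in\mathcal E$: $\sigma\ge0$ is a quasi-eigenvalue iff $1$ is an eigenvalue of $\mathtt T(\sigma)=\mathtt A(\alpha_n)\mathtt B(\ell_n,\sigma)\cdots\mathtt A(\alpha_1)\mathtt B(\ell_1,\sigma)$, multiplicity (for $\sigma>0$) the geometric multiplicity, and multiplicity $1$ for $\sigma=0$. Otherwise, with exceptional vertices $V_{E_1},\dots,V_{E_K}$, $1\le E_1<\dots<E_K=n$, $E_0:=E_K$, $\mathtt U_\kappa(\sigma)=\mathtt B(\ell_{E_\kappa},\sigma)\mathtt A(\alpha_{E_\kappa-1})\mathtt B(\ell_{E_\kappa-1},\sigma)\cdots\mathtt A(\alpha_{E_{\kappa-1}+1})\mathtt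 B(\ell_{E_{\kappa-1}+1},\sigma)$ (indices mod $n$), $\mathbf X_{\rm even}=\frac1{\sqrt2}(e^{-i\pi/4},e^{i\pi/4})^T$, $\mathbf X_{\rm odd}=\frac1{\sqrt2}(e^{i\pi/4},e^{-i\pi/4})^T$, $\mathbf X(\alpha)=\mathbf X_{\rm even}$ if $\mathcal O(\alpha)=1$ else $\mathbf X_{\rm odd}$, $u\cdot v=u_1\bar v_1+u_2\bar v_2$: $\sigma\ge0$ is a quasi-eigenvalue iff $\mathtt U_\kappa(\sigma)\mathbf X(\alpha_{E_{\kappa-1}})\cdot\mathbf X(\alpha_{E_\kappa})=0$ for some $\kappa$, multiplicity of $\sigma>0$ the number of such $\kappa$, multiplicity of $0$ half the number of $\kappa$ with $\mathcal O(\alpha_{E_{\kappa-1}})\ne\mathcal O(\alpha_{E_\kappa})$. *)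

(* Defs.v *)
(* Stdlib (classical reals).  Indices are 0-based: vertex j = V_{j+1},
   edge j = I_{j+1} (joins vertex j-1 mod n to vertex j), alpha j, ell j. *)
From Stdlib Require Import Reals Lra Lia List Arith.
Import ListNotations.
Open Scope R_scope.

Definition count_all (P : nat -> Prop) (k : nat) : Prop :=
  exists l : list nat, NoDup l /\ (forall m, In m l <-> P m) /\ length l = k.

Definition count_below (n : nat) (P : nat -> Prop) (k : nat) : Prop :=
  count_all (fun m => (m < n)%nat /\ P m) k.

(* x : nat -> R lists, non-decreasingly and with multiplicities, the values
   of a multiplicity relation M (M y k : "y has multiplicity k"). x 0 is the
   paper's first element. *)
Definition enumerates (M : R -> nat -> Prop) (x : nat -> R) : Prop :=
  (forall m, x m <= x (S m)) /\
  (forall y, exists k, count_all (fun m => x m = y) k /\ M y k).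

Definition C := (R * R)%type.
Definition C0 : C := (0, 0).
Definition Cr (x : R) : C := (x, 0).
Definition Cadd (a b : C) : C := (fst a + fst b, snd a + snd b).
Definition Cmul (a b : C) : C :=
  (fst a * fst b - snd a * snd b, fst a * snd b + snd a * fst b).
Definition Cconj (a : C) : C := (fst a, - snd a).
Definition Cexpi (t : R) : C := (cos t, sin t).

Definition Vec := (C * C)%type.
Definition Mat := ((C * C) * (C * C))%type.

Definition V0 : Vec := (C0, C0).
Definition vadd (u v : Vec) : Vec := (Cadd (fst u) (fst v), Cadd (snd u) (snd v)).
Definition vscal (c : C) (v : Vec) : Vec := (Cmul c (fst v), Cmul c (snd v)).
Definition mvec (A : Mat) (v : Vec) : Vec :=
  let '((a, b), (c, d)) := A in
  (Cadd (Cmul a (fst v)) (Cmul b (snd v)), Cadd (Cmul c (fst v)) (Cmul d (snd v))).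
Definition mmul (A B : Mat) : Mat :=
  let '((a, b), (c, d)) := A in
  let '((e, f), (g, h)) := B in
  ((Cadd (Cmul a e) (Cmul b g), Cadd (Cmul a f) (Cmul b h)),
   (Cadd (Cmul c e) (Cmul d g), Cadd (Cmul c f) (Cmul d h))).
Definition mid : Mat := ((Cr 1, C0), (C0, Cr 1)).

Definition cdot (u v : Vec) : C :=
  Cadd (Cmul (fst u) (Cconj (fst v))) (Cmul (snd u) (Cconj (snd v))).

Fixpoint vlincomb (cs : list C) (vs : list Vec) : Vec :=
  match cs, vs with
  | c :: cs', v :: vs' => vadd (vscal c v) (vlincomb cs' vs')
  | _, _ => V0
  end.

Definition cindep (vs : list Vec) : Prop :=
  forall cs : list C, length cs = length vs ->
    vlincomb cs vs = V0 -> Forall (fun c => c = C0) cs.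

Definition fixed_dim (T : Mat) (k : nat) : Prop :=
  (exists vs : list Vec, length vs = k /\ Forall (fun v => mvec T v = v) vs /\ cindep vs) /\
  (forall vs : list Vec, Forall (fun v => mvec T v = v) vs -> cindep vs -> (length vs <= k)%nat).

Definition has_eig1 (T : Mat) : Prop := exists v : Vec, v <> V0 /\ mvec T v = v.

Definition Amat (a : R) : Mat :=
  let th := PI ^ 2 / (2 * a) in
  ((Cr (/ sin th), (0, - (cos th / sin th))),
   ((0, cos th / sin th), Cr (/ sin th))).

Definition Bmat (l s : R) : Mat := ((Cexpi (l * s), C0), (C0, Cexpi (- (l * s)))).

Fixpoint Tprod (alpha ell : nat -> R) (s : R) (k : nat) : Mat :=
  match k with
  | O => mid
  | S k' => mmul (mmul (Amat (alpha k')) (Bmat (ell k') s)) (Tprod alpha ell s k')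
  end.

Definition exceptional (a : R) : Prop := exists k : nat, (1 <= k)%nat /\ a = PI / (2 * INR k).

Definition Xeven : Vec :=
  (Cmul (Cr (/ sqrt 2)) (Cexpi (- (PI / 4))), Cmul (Cr (/ sqrt 2)) (Cexpi (PI / 4))).
Definition Xodd : Vec :=
  (Cmul (Cr (/ sqrt 2)) (Cexpi (PI / 4)), Cmul (Cr (/ sqrt 2)) (Cexpi (- (PI / 4)))).

Definition Xof (a : R) (X : Vec) : Prop :=
  exists k : nat, (1 <= k)%nat /\ a = PI / (2 * INR k) /\
    X = (if Nat.even k then Xeven else Xodd).

Definition parity_differs (a b : R) : Prop :=
  exists k k' : nat, (1 <= k)%nat /\ (1 <= k')%nat /\
    a = PI / (2 * INR k) /\ b = PI / (2 * INR k') /\ Nat.even k <> Nat.even k'.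

Definition back (n e t : nat) : nat := ((e + n - t) mod n)%nat.

(* d is the cyclic distance from exceptional vertex e back to the previous
   exceptional vertex (d = n if e is the only one) *)
Definition prev_exc_dist (n : nat) (alpha : nat -> R) (e d : nat) : Prop :=
  (1 <= d <= n)%nat /\ exceptional (alpha (back n e d)) /\
  (forall d', (1 <= d' < d)%nat -> ~ exceptional (alpha (back n e d'))).

Fixpoint Pprod (n : nat) (alpha ell : nat -> R) (e : nat) (s : R) (t : nat) : Mat :=
  match t with
  | O => mid
  | S t' => mmul (Pprod n alpha ell e s t')
                 (mmul (Amat (alpha (back n e t))) (Bmat (ell (back n e t)) s))
  end.

(* U_kappa for E_kappa = e, E_{kappa-1} = e - d:
   B(ell_e) A(alpha_{e-1}) B(ell_{e-1}) ... A(alpha_{e-d+1}) B(ell_{e-d+1}) *)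
Definition Umat (n : nat) (alpha ell : nat -> R) (e d : nat) (s : R) : Mat :=
  mmul (Bmat (ell e) s) (Pprod n alpha ell e s (d - 1)).

Definition exc_cond (n : nat) (alpha ell : nat -> R) (s : R) (e : nat) : Prop :=
  exceptional (alpha e) /\
  exists d X X', prev_exc_dist n alpha e d /\
    Xof (alpha (back n e d)) X /\ Xof (alpha e) X' /\
    cdot (mvec (Umat n alpha ell e d s) X) X' = C0.

Definition parity_change (n : nat) (alpha : nat -> R) (e : nat) : Prop :=
  exceptional (alpha e) /\
  exists d, prev_exc_dist n alpha e d /\ parity_differs (alpha (back n e d)) (alpha e).

(* qmult n alpha ell s k : "s has quasi-eigenvalue multiplicity k"
   (k = 0 when s is not a quasi-eigenvalue) *)
Definition qmult (n : nat) (alpha ell : nat -> R) (s : R) (k : nat) : Prop :=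
  (s < 0 /\ k = 0%nat) \/
  ((forall j, (j < n)%nat -> ~ exceptional (alpha j)) /\
    ((s = 0 /\ ((has_eig1 (Tprod alpha ell 0 n) /\ k = 1%nat) \/
                (~ has_eig1 (Tprod alpha ell 0 n) /\ k = 0%nat))) \/
     (0 < s /\ fixed_dim (Tprod alpha ell s n) k))) \/
  ((exists j, (j < n)%nat /\ exceptional (alpha j)) /\
    ((0 < s /\ count_below n (exc_cond n alpha ell s) k) \/
     (s = 0 /\ (((exists e, (e < n)%nat /\ exc_cond n alpha ell 0 e) /\
                 count_below n (parity_change n alpha) (2 * k))
               \/ (~ (exists e, (e < n)%nat /\ exc_cond n alpha ell 0 e) /\ k = 0%nat))))).

(* f j : R -> R is the function on edge j (only its values on [0, ell j]
   matter); f is an eigenfunction of Delta_G with eigenvalue nu: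
   C^2 on each closed edge with -f'' = nu f, and the vertex matching conditions. *)
Definition graph_eigfun (n : nat) (alpha ell : nat -> R) (nu : R) (f : nat -> R -> R) : Prop :=
  exists f1 f2 : nat -> R -> R,
    (forall j, (j < n)%nat -> forall s, 0 <= s <= ell j ->
       derivable_pt_lim (f j) s (f1 j s) /\
       derivable_pt_lim (f1 j) s (f2 j s) /\
       - f2 j s = nu * f j s) /\
    (forall j, (j < n)%nat ->
       let th := PI ^ 2 / (4 * alpha j) in
       sin th * f (S j mod n)%nat 0 = cos th * f j (ell j) /\
       cos th * f1 (S j mod n)%nat 0 = sin th * f1 j (ell j)).

Fixpoint flincomb (cs : list R) (fs : list (nat -> R -> R)) (j : nat) (s : R) : R :=
  match cs, fs with
  | c :: cs', g :: fs' => c * g j s + flincomb cs' fs' j s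
  | _, _ => 0
  end.

Definition gindep (n : nat) (ell : nat -> R) (fs : list (nat -> R -> R)) : Prop :=
  forall cs : list R, length cs = length fs ->
    (forall j, (j < n)%nat -> forall s, 0 <= s <= ell j -> flincomb cs fs j s = 0) ->
    Forall (fun c => c = 0) cs.

Definition gmult (n : nat) (alpha ell : nat -> R) (nu : R) (k : nat) : Prop :=
  (exists fs, length fs = k /\ Forall (graph_eigfun n alpha ell nu) fs /\ gindep n ell fs) /\
  (forall fs, Forall (graph_eigfun n alpha ell nu) fs -> gindep n ell fs -> (length fs <= k)%nat).

(* Main.v *)
(* On an edge, an eigenfunction for s^2 is determined by its Cauchy data (f, f'/s)
   at the starting point; these data are rotated by ell*s along the edge and scaled
   by diag(cot, tan) of pi^2/(4 alpha) at a non-exceptional vertex. The paper's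
   matrices B and A are these real matrices written in plane-wave amplitudes, so
   without exceptional angles both multiplicities are dim ker(M(s) - 1) for the real
   monodromy M(s) of determinant 1. An exceptional vertex decouples its two edges into
   a Dirichlet and a Neumann end, and X_even, X_odd are the Neumann and Dirichlet data,
   so each segment between consecutive exceptional vertices contributes separately.
   At s = 0 the flux f f' forces f to be constant on edges, and the parity changes
   come in pairs around the cycle.
   Enumerability: tr M(s) - 2 and the segment conditions are trigonometric polynomials
   in s, hence have isolated zeros; and the Cauchy data wind around the origin
   infinitely often as s grows, which produces infinitely many zeros. *)
Require Import Defs.
From Stdlib Require Import ZArith Reals Lra Lia List Arith Permutation Classical ClassicalEpsilon.
Import ListNotations.
Open Scope R_scope.

(** * Finite-dimensional function spaces on the graph *)

(** The spectra are compared value by value: s >= 0 has as a quasi-eigenvalue the multiplicity that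
    s^2 has as an eigenvalue, and a non-decreasing listing is determined by its multiplicities
    ([sorted_unique]). Only explicit solutions of -f'' = nu f enter, no operator theory. One
    multiplicity is a dimension over the complex numbers, the other over the reals. They agree
    because [toC M] is the real matrix M acting on the complexified plane. The fixed space of a real
    2x2 matrix of determinant 1 can be read off from its trace and from whether it is the identity.
    The delicate frequency is 0. There the data (f, f'/s) degenerate: the datum (0, 1) represents
    the zero function and has to be discarded in both cases, which is why the multiplicity at 0
    follows a rule of its own. Isolation of zeros holds only for a trigonometric polynomial that is
    not identically zero. This too is supplied by the winding, which also produces points where the
    function is far from zero. *)

Fixpoint rsum (k : nat) (F : nat -> R) : R :=
  match k with O => 0 | S k' => rsum k' F + F k' end.

Lemma rsum_ext k F G : (forall i, (i < k)%nat -> F i = G i) -> rsum k F = rsum k G.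
Proof. induction k; simpl; intros H; [easy|]. rewrite IHk, H; auto. Qed.

Lemma rsum_zero k F : (forall i, (i < k)%nat -> F i = 0) -> rsum k F = 0.
Proof. induction k; simpl; intros H; [easy|]. rewrite IHk, H; auto; lra. Qed.

Lemma rsum_lin k c F G : rsum k (fun i => c * F i + G i) = c * rsum k F + rsum k G.
Proof. induction k; simpl; [lra|]. rewrite IHk; lra. Qed.

Lemma rsum_single k F i :
  (i < k)%nat -> (forall i', (i' < k)%nat -> i' <> i -> F i' = 0) -> rsum k F = F i.
Proof.
  induction k; simpl; intros Hi H; [lia|].
  destruct (Nat.eq_dec i k) as [->|Hne].
  - rewrite rsum_zero; [lra|]. intros; apply H; lia.
  - rewrite IHk, (H k); try lia; [lra|]. intros; apply H; lia.
Qed.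

Fixpoint rcomb (cs : list R) (rows : list (nat -> R)) (j : nat) : R :=
  match cs, rows with
  | c :: cs', r :: rows' => c * r j + rcomb cs' rows' j
  | _, _ => 0
  end.

Lemma rcomb_app c1 c2 r1 r2 j : length c1 = length r1 ->
  rcomb (c1 ++ c2) (r1 ++ r2) j = rcomb c1 r1 j + rcomb c2 r2 j.
Proof.
  revert r1; induction c1; intros [|r r1] H; simpl in *; try lia; [lra|].
  rewrite IHc1 by lia; lra.
Qed.

Lemma rcomb_elim cs rows r j k :
  rcomb cs (map (fun q => fun i => q i - q k / r k * r i) rows) j
  = rcomb cs rows j - rcomb cs rows k / r k * r j.
Proof.
  revert rows; induction cs; intros [|q rows]; simpl; try (unfold Rdiv; lra).
  rewrite IHcs; unfold Rdiv; lra.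
Qed.

(** Gaussian elimination, one column per step. A row with nonzero entry in the last column clears
    that column in the other rows and is then set aside; if there is no such row, the column already
    vanishes. *)
Lemma rows_dependent k (rows : list (nat -> R)) : (k < length rows)%nat ->
  exists cs, length cs = length rows /\ ~ Forall (fun c => c = 0) cs /\
    forall j, (j < k)%nat -> rcomb cs rows j = 0.
Proof.
  revert rows; induction k; intros rows Hk.
  - destruct rows as [|r rows]; simpl in *; [lia|].
    exists (1 :: repeat 0 (length rows)); simpl; rewrite repeat_length.
    repeat split; [|lia]. intros HF; inversion HF; lra.
  - destruct (classic (exists r, In r rows /\ r k <> 0)) as [[r [Hr Hrk]]|Hno].
    + apply in_split in Hr as [l1 [l2 ->]].
      rewrite length_app in Hk; simpl in Hk.
      destruct (IHk (map (fun q => fun i => q i - q k / r k * r i) (l1 ++ l2)))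
        as [cs [Hl [Hnz Hz]]].
      { rewrite length_map, length_app; lia. }
      rewrite length_map, length_app in Hl.
      set (c1 := firstn (length l1) cs). set (c2 := skipn (length l1) cs).
      assert (E : cs = c1 ++ c2) by (symmetry; apply firstn_skipn).
      assert (L1 : length c1 = length l1) by (unfold c1; rewrite length_firstn; lia).
      (* The pivot row gets minus the total of the multiples of [r] that were subtracted from the
         other rows. *)
      exists (c1 ++ (- (rcomb cs (l1 ++ l2) k / r k)) :: c2).
      split; [rewrite !length_app; simpl; rewrite E, length_app in Hl; lia|].
      split.
      * intros HF; apply Hnz. rewrite E. apply Forall_app in HF as [H1 H2].
        inversion H2; apply Forall_app; split; auto.
      * intros j Hj. rewrite rcomb_app by auto; simpl.
        assert (Ej : forall j, rcomb cs (l1 ++ l2) j = rcomb c1 l1 j + rcomb c2 l2 j).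
        { intros; rewrite E at 1; apply rcomb_app; auto. }
        destruct (Nat.eq_dec j k) as [->|Hne].
        -- rewrite (Ej k); field; auto.
        -- specialize (Hz j ltac:(lia)). rewrite rcomb_elim, (Ej j) in Hz. lra.
    + destruct (IHk rows ltac:(lia)) as [cs [Hl [Hnz Hz]]].
      exists cs; repeat split; auto. intros j Hj.
      destruct (Nat.eq_dec j k) as [->|Hne]; [|apply Hz; lia].
      assert (HA : forall r, In r rows -> r k = 0).
      { intros r Hr; apply NNPP; intros Hc; apply Hno; eauto. }
      clear -HA; revert rows HA; induction cs; intros [|r rows] HA; simpl; try lra.
      rewrite (HA r (or_introl eq_refl)), IHcs by (intros; apply HA; now right); lra.
Qed.

Definition on_graph (n : nat) (ell : nat -> R) (P : nat -> R -> Prop) : Prop :=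
  forall j, (j < n)%nat -> forall s, 0 <= s <= ell j -> P j s.

(** Steinitz bound: a linear relation between the coefficient rows is a relation between the
    functions. *)
Lemma gindep_length n ell k (b : nat -> nat -> R -> R) fs :
  Forall (fun f => exists a, on_graph n ell
     (fun j s => f j s = rsum k (fun i => a i * b i j s))) fs ->
  gindep n ell fs -> (length fs <= k)%nat.
Proof.
  intros HF HI.
  assert (HR : exists rows, length rows = length fs /\ forall cs, on_graph n ell
     (fun j s => flincomb cs fs j s = rsum k (fun i => rcomb cs rows i * b i j s))).
  { clear HI; induction HF as [|f fs [a Ha] _ [rows [Hl IH]]].
    - exists []; split; [easy|]. intros cs j _ s _.
      rewrite rsum_zero; destruct cs; simpl; auto; intros; lra.
    - exists (a :: rows); split; [simpl; lia|]. intros [|c cs] j Hj s Hs; simpl.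
      + rewrite rsum_zero; auto; intros; lra.
      + rewrite (Ha j Hj s Hs), (IH cs j Hj s Hs), <- rsum_lin.
        apply rsum_ext; intros; ring. }
  destruct HR as [rows [Hl HR]].
  apply Nat.nlt_ge; intros Hlt.
  destruct (rows_dependent k rows ltac:(lia)) as [cs [Hc [Hnz Hz]]].
  apply Hnz, HI; [lia|]. intros j Hj s Hs. rewrite (HR cs j Hj s Hs).
  apply rsum_zero; intros i Hi; rewrite Hz; auto; lra.
Qed.

Lemma flincomb_map n0 k (b : nat -> nat -> R -> R) cs j s : length cs = k ->
  flincomb cs (map b (seq n0 k)) j s = rsum k (fun i => nth i cs 0 * b (n0 + i)%nat j s).
Proof.
  assert (Hs : forall k F, rsum (S k) F = F O + rsum k (fun i => F (S i))).
  { intros m F; induction m; [simpl; lra|].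
    change (rsum (S (S m)) F) with (rsum (S m) F + F (S m)); rewrite IHm; simpl; lra. }
  revert n0 k; induction cs as [|c cs IH]; intros n0 [|k] Hl; try easy.
  simpl in Hl. rewrite Hs. simpl. rewrite (IH (S n0) k) by lia.
  rewrite Nat.add_0_r. f_equal. apply rsum_ext; intros; do 2 f_equal; lia.
Qed.

(** Every value of [gmult] is established through this criterion: a basis indexed by the numbers
    below k gives both the existence and the maximality half. *)
Lemma gmult_basis n alpha ell nu k (b : nat -> nat -> R -> R) :
  (forall i, (i < k)%nat -> graph_eigfun n alpha ell nu (b i)) ->
  (forall a, on_graph n ell (fun j s => rsum k (fun i => a i * b i j s) = 0) ->
     forall i, (i < k)%nat -> a i = 0) ->
  (forall f, graph_eigfun n alpha ell nu f -> exists a, on_graph n ell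
     (fun j s => f j s = rsum k (fun i => a i * b i j s))) ->
  gmult n alpha ell nu k.
Proof.
  intros He Hi Hs; split.
  - exists (map b (seq 0 k)); repeat split.
    + now rewrite length_map, length_seq.
    + apply Forall_forall; intros f Hf; apply in_map_iff in Hf as [i [<- Hi']].
      apply in_seq in Hi'; apply He; lia.
    + intros cs Hl Hz. rewrite length_map, length_seq in Hl.
      apply Forall_forall; intros c Hc.
      apply (In_nth _ _ 0) in Hc as [i [Hlt <-]].
      apply (Hi (fun i => nth i cs 0)); [|lia].
      intros j Hj s Hs1. specialize (Hz j Hj s Hs1). rewrite (flincomb_map 0 k) in Hz by auto. exact Hz.
  - intros fs HF HI; apply (gindep_length n ell k b fs); auto.
    eapply Forall_impl; [|exact HF]. auto.
Qed.

Lemma gmult_unique n alpha ell nu k k' :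
  gmult n alpha ell nu k -> gmult n alpha ell nu k' -> k = k'.
Proof.
  intros [[fs [<- [H1 H2]]] H3] [[fs' [<- [H1' H2']]] H3'].
  apply Nat.le_antisymm; auto.
Qed.

(** * Enumeration with multiplicities *)

Lemma nondecreasing_le (x : nat -> R) : (forall m, x m <= x (S m)) ->
  forall i j, (i <= j)%nat -> x i <= x j.
Proof. intros H i j Hij; induction Hij; [lra|]. specialize (H m); lra. Qed.

(** Consider the first index m where the sequences differ, say x m < y m. By monotonicity every i
    with y i = x m precedes m, where x and y agree, so x takes the value x m at least once more than
    y does. *)
Lemma sorted_unique (x y : nat -> R) :
  (forall m, x m <= x (S m)) -> (forall m, y m <= y (S m)) ->
  (forall v, exists k, count_all (fun m => x m = v) k /\ count_all (fun m => y m = v) k) ->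
  forall m, x m = y m.
Proof.
  assert (Hgen : forall x y : nat -> R, (forall m, y m <= y (S m)) ->
    (forall v, exists k, count_all (fun m => x m = v) k /\ count_all (fun m => y m = v) k) ->
    forall m, (forall i, (i < m)%nat -> x i = y i) -> ~ x m < y m).
  { clear x y; intros x y Hy Hc m Hm Hlt.
    destruct (Hc (x m)) as [k [[lx [Dx [Ix Lx]]] [ly [Dy [Iy Ly]]]]].
    assert (Hsmall : forall i, In i ly -> (i < m)%nat).
    { intros i Hi; apply Iy in Hi. apply Nat.nle_gt; intros Hmi.
      pose proof (nondecreasing_le y Hy m i Hmi); lra. }
    assert (Hle : (length (m :: ly) <= length lx)%nat).
    { apply NoDup_incl_length.
      - constructor; auto. intros Hi; specialize (Hsmall m Hi); lia.
      - intros i [<-|Hi]; apply Ix; auto. rewrite Hm by auto. now apply Iy. }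
    simpl in Hle; lia. }
  intros Hx Hy Hc m. induction m as [m IH] using lt_wf_ind.
  assert (H1 := Hgen x y Hy Hc m IH).
  assert (H2 : ~ y m < x m).
  { apply Hgen; auto; [|intros; symmetry; auto].
    intros v; destruct (Hc v) as [k [? ?]]; eauto. }
  lra.
Qed.

Lemma list_sum_incl (f : R -> nat) l l' : NoDup l -> incl l l' ->
  (list_sum (map f l) <= list_sum (map f l'))%nat.
Proof.
  intros HD; revert l'; induction HD as [|a l Ha HD IH]; intros l' Hi; simpl; [lia|].
  destruct (in_split a l' (Hi a (or_introl eq_refl))) as [l1 [l2 ->]].
  rewrite map_app, list_sum_app; simpl.
  specialize (IH (l1 ++ l2)). rewrite map_app, list_sum_app in IH.
  enough (incl l (l1 ++ l2)) by (specialize (IH H); lia).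
  intros b Hb. specialize (Hi b (or_intror Hb)).
  apply in_app_or in Hi as [|[<-|]]; try easy; apply in_or_app; auto.
Qed.

Lemma list_min (P : R -> Prop) l : (exists y, In y l /\ P y) ->
  exists y, P y /\ forall z, In z l -> P z -> y <= z.
Proof.
  induction l as [|a l IH]; intros [y [Hy HP]]; [easy|].
  destruct (classic (exists y, In y l /\ P y)) as [He|Hn].
  - destruct (IH He) as [m [Pm Hm]].
    destruct (classic (P a /\ a < m)) as [[Pa Ha]|Hna].
    + exists a; split; auto. intros z [<-|Hz] Pz; [lra|]. specialize (Hm z Hz Pz); lra.
    + exists m; split; auto. intros z [<-|Hz] Pz; auto.
      apply Rnot_lt_le; auto.
  - destruct Hy as [<-|Hy]; [|exfalso; eauto].
    exists a; split; auto. intros z [<-|Hz] Pz; [lra|exfalso; eauto].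
Qed.

(* With N(y) the number of values below y counted with multiplicity, the m-th
   term of the sequence is the unique y with N(y) <= m < N(y) + mu(y). *)
Lemma enumerates_exists (M : R -> nat -> Prop) (mu : R -> nat) :
  (forall y, M y (mu y)) ->
  (forall L, exists l, forall y, y <= L -> mu y <> 0%nat -> In y l) ->
  (forall L, exists y, L < y /\ mu y <> 0%nat) ->
  exists x, enumerates M x.
Proof.
  intros HM Hfin Hinf.
  assert (Hbelow : forall t, exists l, NoDup l /\ forall y, In y l <-> y < t /\ mu y <> 0%nat).
  { intros t; destruct (Hfin t) as [l Hl].
    exists (nodup Req_dec_T (filter (fun y => if Rlt_dec y t then negb (mu y =? 0)%nat else false) l)).
    split; [apply NoDup_nodup|]. intros y; rewrite nodup_In, filter_In.
    destruct (Rlt_dec y t) as [H|H]; [|split; [easy|tauto]].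
    rewrite Bool.negb_true_iff, Nat.eqb_neq. split; [tauto|]. intros [H1 H2]; repeat split; auto. apply Hl; auto; lra. }
  set (below t := proj1_sig (constructive_indefinite_description _ (Hbelow t))).
  assert (HB : forall t, NoDup (below t) /\ forall y, In y (below t) <-> y < t /\ mu y <> 0%nat)
    by (intros t; exact (proj2_sig (constructive_indefinite_description _ (Hbelow t)))).
  set (N t := list_sum (map mu (below t))).
  (* Least elements exist because only finitely many points of positive multiplicity lie below any
     given one. *)
  assert (Hmin : forall P : R -> Prop, (exists y, P y /\ mu y <> 0%nat) ->
     exists y, (P y /\ mu y <> 0%nat) /\ forall z, P z -> mu z <> 0%nat -> y <= z).
  { intros P [y [Py Hy]]. destruct (Hfin y) as [l Hl].
    destruct (list_min (fun z => P z /\ mu z <> 0%nat) l) as [m [Hm1 Hm2]].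
    - exists y; repeat split; auto. apply Hl; auto; lra.
    - exists m; split; auto. intros z Pz Hz.
      destruct (Rle_dec z y) as [Hzy|Hzy]; [apply Hm2; auto|].
      specialize (Hm2 y (Hl y (Rle_refl y) Hy) (conj Py Hy)); lra. }
  assert (Hmono : forall y y', y < y' -> (N y + mu y <= N y')%nat).
  { intros y y' Hlt. destruct (Nat.eq_dec (mu y) 0) as [E|E].
    - rewrite E, Nat.add_0_r. apply list_sum_incl; [apply HB|].
      intros z Hz; apply HB in Hz; apply HB; split; [lra|tauto].
    - replace (N y + mu y)%nat with (list_sum (map mu (y :: below y))) by (simpl; unfold N; lia).
      apply list_sum_incl.
      + constructor; [|apply HB]. rewrite (proj2 (HB y)); lra.
      + intros z [<-|Hz]; [apply HB; auto|]. apply HB in Hz; apply HB; split; [lra|tauto]. }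
  assert (Hnext : forall y y', y < y' -> (forall z, z < y' -> mu z <> 0%nat -> z <= y) ->
     (N y' <= N y + mu y)%nat).
  { intros y y' Hlt Hgap.
    replace (N y + mu y)%nat with (list_sum (map mu (y :: below y))) by (simpl; unfold N; lia).
    apply list_sum_incl; [apply HB|]. intros z Hz; apply HB in Hz as [Hz1 Hz2].
    destruct (Req_dec_T z y) as [->|Hne]; [now left|right].
    apply HB; split; auto. specialize (Hgap z Hz1 Hz2); lra. }
  assert (Hex : forall m, exists y, (N y <= m < N y + mu y)%nat).
  { induction m as [|m [y Hy]].
    - destruct (Hmin (fun _ => True)) as [y [[_ Hy] Hl]].
      { destruct (Hinf 0) as [y [_ Hy]]; eauto. }
      exists y. assert (E : N y = 0%nat); [|lia].
      unfold N. destruct (below y) as [|z l] eqn:El; [easy|].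
      assert (Hz : In z (below y)) by (rewrite El; now left).
      apply HB in Hz as [Hz1 Hz2]. specialize (Hl z I Hz2); lra.
    - destruct (Nat.eq_dec (S m) (N y + mu y)) as [E|E]; [|exists y; lia].
      (* The block of y is used up. The next point y' of positive multiplicity has nothing between y
         and itself, so N y' = N y + mu y. *)
      destruct (Hmin (fun z => y < z)) as [y' [[Hy' Hy2] Hl]]; [apply Hinf|].
      exists y'.
      assert (N y' <= N y + mu y)%nat.
      { apply Hnext; auto. intros z Hz Hmz.
        apply Rnot_lt_le; intros Hc. specialize (Hl z Hc Hmz); lra. }
      specialize (Hmono y y' Hy'). lia. }
  set (x m := proj1_sig (constructive_indefinite_description _ (Hex m))).
  assert (Hx : forall m, (N (x m) <= m < N (x m) + mu (x m))%nat)
    by (intros m; exact (proj2_sig (constructive_indefinite_description _ (Hex m)))).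
  exists x; split.
  - intros m; apply Rnot_lt_le; intros Hc. specialize (Hmono _ _ Hc).
    pose proof (Hx m); pose proof (Hx (S m)); lia.
  - intros y; exists (mu y); split; auto.
    exists (seq (N y) (mu y)); repeat split.
    + apply seq_NoDup.
    + rewrite in_seq; intros Hm. pose proof (Hx m).
      destruct (Rtotal_order (x m) y) as [Hc|[|Hc]]; auto; specialize (Hmono _ _ Hc); lia.
    + intros <-; rewrite in_seq; apply Hx.
    + apply length_seq.
Qed.

(** * Zeros of trigonometric polynomials *)

(** A triple is (amplitude, frequency, phase). The phase lets cosines represent sines, and
    differentiation becomes a shift of the phase by PI/2 at unchanged frequency. *)
Fixpoint trig (l : list (R * R * R)) (x : R) : R :=
  match l with
  | [] => 0
  | (a, w, p) :: l' => a * cos (w * x + p) + trig l' x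
  end.

Definition trig_deriv : list (R * R * R) -> list (R * R * R) :=
  map (fun t => let '(a, w, p) := t in (a * w, w, p + PI / 2)).

Fixpoint trig_norm (l : list (R * R * R)) : R :=
  match l with
  | [] => 0
  | (a, _, _) :: l' => Rabs a + trig_norm l'
  end.

Definition freq_le (W : R) : list (R * R * R) -> Prop :=
  Forall (fun t => let '(_, w, _) := t in Rabs w <= W).

Lemma trig_app l l' x : trig (l ++ l') x = trig l x + trig l' x.
Proof. induction l as [|[[a w] p] l IH]; simpl; lra. Qed.

Lemma trig_derivable l x : derivable_pt_lim (trig l) x (trig (trig_deriv l) x).
Proof.
  induction l as [|[[a w] p] l IH]; simpl.
  - apply derivable_pt_lim_const.
  - apply (derivable_pt_lim_plus (fun x => a * cos (w * x + p)) (trig l)); auto.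
    replace (a * w * cos (w * x + (p + PI / 2))) with (a * (- sin (w * x + p) * (w * 1 + 0))).
    + apply (derivable_pt_lim_scal (fun x => cos (w * x + p))).
      apply (derivable_pt_lim_comp (fun x => w * x + p) cos).
      * apply (derivable_pt_lim_plus (fun x => w * x) (fun _ => p)).
        -- apply (derivable_pt_lim_scal id), derivable_pt_lim_id.
        -- apply derivable_pt_lim_const.
      * apply derivable_pt_lim_cos.
    + rewrite <- Rplus_assoc, cos_plus, cos_PI2, sin_PI2. ring.
Qed.

Lemma trig_continuous l x : continuity_pt (trig l) x.
Proof.
  apply derivable_continuous_pt. exists (trig (trig_deriv l) x). apply trig_derivable.
Qed.

Lemma trig_norm_pos l : 0 <= trig_norm l.
Proof. induction l as [|[[a w] p] l IH]; simpl; [lra|]. pose proof (Rabs_pos a); lra. Qed.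

Lemma trig_bound l x : Rabs (trig l x) <= trig_norm l.
Proof.
  induction l as [|[[a w] p] l IH]; simpl; [rewrite Rabs_R0; lra|].
  eapply Rle_trans; [apply Rabs_triang|]. rewrite Rabs_mult.
  assert (Rabs (cos (w * x + p)) <= 1) by (apply Rabs_le; apply COS_bound).
  pose proof (Rabs_pos a). nra.
Qed.

Lemma freq_le_deriv W l : freq_le W l -> freq_le W (trig_deriv l).
Proof.
  intros H; apply Forall_map; eapply Forall_impl; [|exact H].
  now intros [[a w] p].
Qed.

(** Bernstein-type bound. As the frequencies do not change, each further derivative costs the same
    factor W. *)
Lemma trig_norm_deriv W l : freq_le W l -> trig_norm (trig_deriv l) <= W * trig_norm l.
Proof.
  induction 1 as [|[[a w] p] l Hw _ IH]; simpl; [lra|].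
  rewrite Rabs_mult. pose proof (Rabs_pos a). nra.
Qed.

Lemma freq_le_exists l : exists W, 0 < W /\ freq_le W l.
Proof.
  induction l as [|[[a w] p] l [W [HW IH]]].
  - exists 1; split; [lra|constructor].
  - exists (W + Rabs w). pose proof (Rabs_pos w). split; [lra|].
    constructor; [lra|]. eapply Forall_impl; [|exact IH].
    intros [[a' w'] p']; lra.
Qed.

Definition zeros_cluster (f : R -> R) (x : R) : Prop :=
  forall eps, 0 < eps -> exists y, y <> x /\ Rabs (y - x) < eps /\ f y = 0.

Lemma zeros_cluster_zero f x : continuity_pt f x -> zeros_cluster f x -> f x = 0.
Proof.
  intros Hc Hz. apply NNPP; intros Hne.
  destruct (Hc (Rabs (f x)) (Rabs_pos_lt _ Hne)) as [d [Hd H]].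
  destruct (Hz d Hd) as [y [Hy1 [Hy2 Hy3]]].
  specialize (H y). simpl in H; unfold Rdist in H. rewrite Hy3 in H.
  assert (Rabs (0 - f x) < Rabs (f x)).
  { apply H; split; auto. split; [exact I|auto]. }
  rewrite Rminus_0_l, Rabs_Ropp in H0; lra.
Qed.

Lemma mean_value l x y : x <> y -> exists c,
  trig l y - trig l x = trig (trig_deriv l) c * (y - x) /\ c <> x /\ Rabs (c - x) < Rabs (y - x).
Proof.
  assert (G : forall a b, a < b -> exists c,
    trig l b - trig l a = trig (trig_deriv l) c * (b - a) /\ a < c < b).
  { intros a b Hab. apply MVT_cor2; auto. intros; apply trig_derivable. }
  intros Hne. destruct (Rlt_or_le x y) as [H|H].
  - destruct (G x y H) as [c [E Hc]]. exists c; repeat split; auto; [lra|].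
    rewrite !Rabs_pos_eq; lra.
  - destruct (G y x ltac:(lra)) as [c [E Hc]]. exists c; repeat split; [lra|lra|].
    rewrite !Rabs_left1; lra.
Qed.

(** Rolle's theorem between x and a nearby zero. *)
Lemma zeros_cluster_deriv l x :
  zeros_cluster (trig l) x -> zeros_cluster (trig (trig_deriv l)) x.
Proof.
  intros Hz eps He.
  assert (H0 : trig l x = 0) by (apply zeros_cluster_zero; auto; apply trig_continuous).
  destruct (Hz eps He) as [y [Hy1 [Hy2 Hy3]]].
  destruct (mean_value l x y ltac:(auto)) as [c [E [Hc1 Hc2]]].
  exists c; repeat split; auto; [lra|].
  rewrite H0, Hy3 in E. assert (y - x <> 0) by lra.
  apply (Rmult_eq_reg_r (y - x)); auto; lra.
Qed.

(* All derivatives vanish at a cluster point, so m applications of the mean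
   value theorem on an interval of radius 1/(2W) gain a factor 2^-m. *)
Lemma trig_small m : forall W l x y, 0 < W -> freq_le W l -> zeros_cluster (trig l) x ->
  Rabs (y - x) <= / (2 * W) -> Rabs (trig l y) <= trig_norm l * (/ 2) ^ m.
Proof.
  induction m; intros W l x y HW Hl Hz Hy; simpl.
  - rewrite Rmult_1_r; apply trig_bound.
  - assert (H0 : trig l x = 0) by (apply zeros_cluster_zero; auto; apply trig_continuous).
    assert (Hp : 0 <= (/ 2) ^ m) by (apply pow_le; lra).
    pose proof (trig_norm_pos l) as Hn.
    destruct (Req_dec y x) as [->|Hne].
    { rewrite H0, Rabs_R0. apply Rmult_le_pos; [auto|lra]. }
    destruct (mean_value l x y ltac:(auto)) as [c [E [Hc1 Hc2]]].
    rewrite H0, Rminus_0_r in E. rewrite E, Rabs_mult.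
    assert (H1 : Rabs (trig (trig_deriv l) c) <= trig_norm (trig_deriv l) * (/ 2) ^ m).
    { apply (IHm W _ x); auto using freq_le_deriv, zeros_cluster_deriv. lra. }
    pose proof (trig_norm_deriv W l Hl) as H2.
    apply Rle_trans with (trig_norm (trig_deriv l) * (/ 2) ^ m * / (2 * W)).
    + apply Rmult_le_compat; auto using Rabs_pos.
    + apply Rle_trans with (W * trig_norm l * (/ 2) ^ m * / (2 * W)).
      * apply Rmult_le_compat_r; [left; apply Rinv_0_lt_compat; lra|].
        apply Rmult_le_compat_r; auto.
      * right; field; lra.
Qed.

Lemma trig_zero_near W l x y : 0 < W -> freq_le W l -> zeros_cluster (trig l) x ->
  Rabs (y - x) <= / (2 * W) -> trig l y = 0.
Proof.
  intros HW Hl Hz Hy. apply NNPP; intros Hne.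
  apply Rabs_pos_lt in Hne.
  assert (Hn : 0 < trig_norm l) by (pose proof (trig_bound l y); lra).
  destruct (pow_lt_1_zero (/ 2) ltac:(rewrite Rabs_pos_eq; lra)
    (Rabs (trig l y) / trig_norm l)) as [m Hm].
  { apply Rdiv_lt_0_compat; auto. }
  specialize (Hm m (le_n _)). rewrite Rabs_pos_eq in Hm by (apply pow_le; lra).
  pose proof (trig_small m W l x y HW Hl Hz Hy) as H.
  apply (Rmult_lt_compat_l (trig_norm l)) in Hm; auto.
  replace (trig_norm l * (Rabs (trig l y) / trig_norm l)) with (Rabs (trig l y)) in Hm
    by (field; lra). lra.
Qed.

(** The radius 1/(2W) of vanishing does not depend on the point, so clustering of zeros propagates
    along the whole line in steps of that length. *)
Lemma trig_identity l x : zeros_cluster (trig l) x -> forall y, trig l y = 0.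
Proof.
  intros Hz. destruct (freq_le_exists l) as [W [HW Hl]].
  assert (Hr : 0 < / (2 * W)) by (apply Rinv_0_lt_compat; lra).
  assert (Hstep : forall x y, zeros_cluster (trig l) x -> Rabs (y - x) <= / (2 * W) ->
    zeros_cluster (trig l) y).
  { clear x Hz; intros x y Hz Hy. destruct (Req_dec y x) as [->|Hne]; auto.
    (* A zero close to y is taken on the segment from y towards x: it is nearer to x than y is,
       hence still within the radius. *)
    intros eps He. set (t := Rmin (1 / 2) (eps / (2 * Rabs (x - y)))).
    assert (Hp : 0 < Rabs (x - y)) by (apply Rabs_pos_lt; lra).
    assert (Hq : 0 < eps / (2 * Rabs (x - y))) by (apply Rdiv_lt_0_compat; lra).
    assert (Ht : 0 < t <= 1 / 2) by (split; [apply Rmin_glb_lt; lra|apply Rmin_l]).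
    exists (y + t * (x - y)). repeat split.
    - intros E. assert (Ex : x - y <> 0) by lra.
      assert (t * (x - y) = 0) by lra. apply Rmult_integral in H; lra.
    - replace (y + t * (x - y) - y) with (t * (x - y)) by ring.
      rewrite Rabs_mult, (Rabs_pos_eq t) by lra.
      apply Rle_lt_trans with (eps / (2 * Rabs (x - y)) * Rabs (x - y)).
      + apply Rmult_le_compat_r; [lra|apply Rmin_r].
      + replace (eps / (2 * Rabs (x - y)) * Rabs (x - y)) with (eps / 2) by (field; lra). lra.
    - apply (trig_zero_near W l x); auto.
      replace (y + t * (x - y) - x) with ((1 - t) * (y - x)) by ring.
      rewrite Rabs_mult, (Rabs_pos_eq (1 - t)) by lra.
      pose proof (Rabs_pos (y - x)). nra. }
  assert (Hall : forall k y, Rabs (y - x) <= INR k * / (2 * W) -> zeros_cluster (trig l) y).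
  { induction k; intros y Hy.
    - simpl in Hy. apply (Hstep x); auto. lra.
    - rewrite S_INR in Hy.
      (* z divides the way from x to y so that it is within k radii of x and one radius of y. *)
      set (z := x + (y - x) * (INR k / (INR k + 1))).
      pose proof (pos_INR k) as Hk.
      apply (Hstep z).
      + apply IHk. unfold z.
        replace (x + (y - x) * (INR k / (INR k + 1)) - x)
          with ((y - x) * (INR k / (INR k + 1))) by ring.
        rewrite Rabs_mult, (Rabs_pos_eq (INR k / (INR k + 1)))
          by (apply Rle_mult_inv_pos; lra).
        apply Rle_trans with ((INR k + 1) * / (2 * W) * (INR k / (INR k + 1))).
        * apply Rmult_le_compat_r; auto. apply Rle_mult_inv_pos; lra.
        * right; field; lra.
      + unfold z.
        replace (y - (x + (y - x) * (INR k / (INR k + 1))))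
          with ((y - x) * (1 / (INR k + 1))) by (field; lra).
        rewrite Rabs_mult, (Rabs_pos_eq (1 / (INR k + 1)))
          by (apply Rle_mult_inv_pos; lra).
        apply Rle_trans with ((INR k + 1) * / (2 * W) * (1 / (INR k + 1))).
        * apply Rmult_le_compat_r; auto. apply Rle_mult_inv_pos; lra.
        * right; field; lra. }
  intros y. apply zeros_cluster_zero; [apply trig_continuous|].
  destruct (INR_unbounded (Rabs (y - x) * (2 * W))) as [k Hk].
  apply (Hall k). apply (Rmult_le_reg_r (2 * W)); [lra|].
  rewrite Rmult_assoc, Rinv_l by lra. lra.
Qed.

(** Compactness of [a, b] by a supremum argument: if s is the supremum of the t for which [a, t]
    meets P in finitely many points, the isolating interval at s carries finiteness beyond s, unless
    s = b. *)
Lemma isolated_finite (P : R -> Prop) a b :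
  (forall x, exists eps, 0 < eps /\ forall y, y <> x -> Rabs (y - x) < eps -> ~ P y) ->
  exists l, forall y, a <= y <= b -> P y -> In y l.
Proof.
  intros Hiso.
  destruct (Rlt_or_le b a) as [Hba|Hab]; [exists []; intros; lra|].
  set (E t := a <= t <= b /\ exists l, forall y, a <= y <= t -> P y -> In y l).
  assert (Ea : E a).
  { split; [lra|]. exists [a]. intros y Hy _; left; lra. }
  destruct (completeness E) as [s [Hub Hlub]].
  { exists b; intros t [Ht _]; lra. }
  { exists a; auto. }
  assert (Has : a <= s) by (apply Hub; auto).
  assert (Hsb : s <= b) by (apply Hlub; intros t [Ht _]; lra).
  destruct (Hiso s) as [eps [He H]].
  assert (Hex : exists t, E t /\ s - eps < t).
  { apply NNPP; intros Hn. assert (s <= s - eps); [|lra].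
    apply Hlub; intros t Ht. apply Rnot_lt_le; intros Hc; apply Hn; eauto. }
  destruct Hex as [t [[Ht [l Hl]] Hts]].
  assert (Hext : forall y, a <= y < s + eps -> P y -> In y (s :: l)).
  { intros y Hy Py. destruct (Rle_dec y t) as [Hyt|Hyt]; [right; apply Hl; auto; lra|].
    destruct (Req_dec y s) as [->|Hne]; [now left|].
    exfalso; apply (H y); auto. apply Rabs_def1; lra. }
  destruct (Rlt_or_le s b) as [Hlt|Hge].
  - assert (E (Rmin b (s + eps / 2))).
    { split; [split; [apply Rmin_glb; lra|apply Rmin_l]|].
      exists (s :: l). intros y Hy Py; apply Hext; auto.
      pose proof (Rmin_r b (s + eps / 2)); lra. }
    apply Hub in H0.
    assert (s < Rmin b (s + eps / 2)) by (apply Rmin_glb_lt; lra). lra.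
  - exists (s :: l). intros y Hy; apply Hext; lra.
Qed.

Definition is_trig (f : R -> R) : Prop := exists l, forall x, f x = trig l x.

Lemma is_trig_finite_zeros f a b : is_trig f -> (exists x, f x <> 0) ->
  exists l, forall y, a <= y <= b -> f y = 0 -> In y l.
Proof.
  intros [l Hl] [x0 Hx0]. apply isolated_finite. intros x.
  apply NNPP; intros Hn. apply Hx0. rewrite Hl. apply (trig_identity l x).
  intros eps He. apply NNPP; intros Hn2. apply Hn. exists eps; split; auto.
  intros y Hy1 Hy2 Hy3. apply Hn2. exists y; rewrite <- Hl; auto.
Qed.

Lemma is_trig_ext f g : (forall x, f x = g x) -> is_trig f -> is_trig g.
Proof. intros E [l Hl]; exists l; intros x; now rewrite <- E. Qed.

Lemma is_trig_const c : is_trig (fun _ => c).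
Proof. exists [(c, 0, 0)]. intros x; simpl. rewrite Rmult_0_l, Rplus_0_l, cos_0; lra. Qed.

Lemma is_trig_plus f g : is_trig f -> is_trig g -> is_trig (fun x => f x + g x).
Proof.
  intros [l Hl] [l' Hl']. exists (l ++ l'). intros x. now rewrite trig_app, Hl, Hl'.
Qed.

(** The product-to-sum formula keeps the entries of products of rotations in the class. *)
Lemma is_trig_mul_cos w p f : is_trig f -> is_trig (fun x => cos (w * x + p) * f x).
Proof.
  intros [l Hl].
  exists (flat_map (fun t => let '(a, v, q) := t in
            [(a / 2, w + v, p + q); (a / 2, w - v, p - q)]) l).
  intros x; rewrite Hl; clear. induction l as [|[[a v] q] l IH]; simpl; [lra|].
  rewrite <- IH.
  replace ((w + v) * x + (p + q)) with ((w * x + p) + (v * x + q)) by ring.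
  replace ((w - v) * x + (p - q)) with ((w * x + p) - (v * x + q)) by ring.
  generalize (w * x + p) (v * x + q); intros A B.
  rewrite cos_plus, cos_minus; field.
Qed.

Lemma is_trig_scal c f : is_trig f -> is_trig (fun x => c * f x).
Proof.
  intros [l Hl]. exists (map (fun t => let '(a, v, q) := t in (c * a, v, q)) l).
  intros x; rewrite Hl; clear. induction l as [|[[a v] q] l IH]; simpl; [lra|].
  rewrite <- IH; ring.
Qed.

(** * Real transfer matrices and winding *)

Definition RMat := ((R * R) * (R * R))%type.
Definition rmv (M : RMat) (v : R * R) : R * R :=
  let '((a, b), (c, d)) := M in (a * fst v + b * snd v, c * fst v + d * snd v).
Definition rmm (A B : RMat) : RMat :=
  let '((a, b), (c, d)) := A in
  let '((e, f), (g, h)) := B in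
  ((a * e + b * g, a * f + b * h), (c * e + d * g, c * f + d * h)).
Definition rid : RMat := ((1, 0), (0, 1)).
Definition rdet (M : RMat) : R := let '((a, b), (c, d)) := M in a * d - b * c.
Definition radj (M : RMat) : RMat := let '((a, b), (c, d)) := M in ((d, - b), (- c, a)).
Definition rtr (M : RMat) : R := let '((a, b), (c, d)) := M in a + d.
Definition rot (t : R) : RMat := ((cos t, sin t), (- sin t, cos t)).
Definition theta (a : R) : R := PI ^ 2 / (4 * a).
Definition vmat (a : R) : RMat :=
  ((cos (theta a) / sin (theta a), 0), (0, sin (theta a) / cos (theta a))).

Lemma rmv_rmm A B v : rmv (rmm A B) v = rmv A (rmv B v).
Proof.
  destruct A as [[a b] [c d]], B as [[e f] [g h]], v as [x y]; simpl; f_equal; ring.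
Qed.

Lemma rdet_rmm A B : rdet (rmm A B) = rdet A * rdet B.
Proof. destruct A as [[a b] [c d]], B as [[e f] [g h]]; simpl; ring. Qed.

Lemma rdet_rot t : rdet (rot t) = 1.
Proof. simpl. pose proof (sin2_cos2 t) as H; unfold Rsqr in H; lra. Qed.

Lemma rmv_radj M v : rdet M = 1 -> rmv M (rmv (radj M) v) = v.
Proof.
  destruct M as [[a b] [c d]], v as [x y]; simpl; intros H.
  assert (E : a * d = 1 + b * c) by lra.
  f_equal.
  - replace (a * (d * x + - b * y) + b * (- c * x + a * y)) with ((a * d - b * c) * x) by ring.
    rewrite H; ring.
  - replace (c * (d * x + - b * y) + d * (- c * x + a * y)) with ((a * d - b * c) * y) by ring.
    rewrite H; ring.
Qed.

Lemma rmv_radj_l M v : rdet M = 1 -> rmv (radj M) (rmv M v) = v.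
Proof.
  intros H. destruct M as [[a b] [c d]].
  rewrite <- (rmv_radj (radj ((a, b), (c, d))) v) at 2 by (simpl in *; lra).
  simpl. f_equal; ring.
Qed.

(** [phi] is a continuous angle measured clockwise, the direction in which [rot] turns, whence the
    minus sign. Only linear growth from below is recorded: an edge adds to the rate a, a vertex adds
    a bounded loss to K. *)
Definition winding (v : R -> R * R) (a K : R) : Prop :=
  exists phi r : R -> R, continuity phi /\ (forall s, 0 < r s) /\
    (forall s, v s = (r s * cos (phi s), - (r s * sin (phi s)))) /\
    (forall s, 0 <= s -> a * s - K <= phi s).

Lemma winding_ext v w a K : (forall s, v s = w s) -> winding v a K -> winding w a K.
Proof.
  intros E [phi [r [H1 [H2 [H3 H4]]]]]. exists phi, r; repeat split; auto.
  intros s; now rewrite <- E.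
Qed.

Lemma winding_rot v a K l : winding v a K ->
  winding (fun s => rmv (rot (l * s)) (v s)) (l + a) K.
Proof.
  intros [phi [r [H1 [H2 [H3 H4]]]]].
  exists (fun s => phi s + l * s), r; repeat split; auto.
  - apply (continuity_plus phi (fun s => l * s)); auto.
    apply (continuity_scal id). apply derivable_continuous, derivable_id.
  - intros s; rewrite H3; simpl. rewrite cos_plus, sin_plus; f_equal; ring.
  - intros s Hs; specialize (H4 s Hs); lra.
Qed.

Lemma winding_opp v a K : winding v a K -> winding (fun s => (- fst (v s), - snd (v s))) a K.
Proof.
  intros [phi [r [H1 [H2 [H3 H4]]]]].
  exists (fun s => phi s + PI), r; repeat split; auto.
  - apply (continuity_plus phi (fun s => PI)); auto. apply continuity_const; now intros ? ?.
  - intros s; rewrite H3; simpl. rewrite neg_cos, neg_sin; f_equal; ring.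
  - intros s Hs; specialize (H4 s Hs); pose proof PI_RGT_0; lra.
Qed.

(** A positive diagonal matrix keeps the inner product of a vector with its image positive, so it
    turns the vector by less than a right angle. The arctangent is then a continuous choice of the
    turn, which replaces a general lifting argument and bounds the loss by PI/2. *)
Lemma winding_dil_pos v a K c : 0 < c -> winding v a K ->
  winding (fun s => (c * fst (v s), / c * snd (v s))) a (K + PI / 2).
Proof.
  intros Hc [phi [r [H1 [H2 [H3 H4]]]]].
  assert (Hic : 0 < / c) by (apply Rinv_0_lt_compat; auto).
  (* For the unit vector at angle [phi], D is the inner product with its image and N the signed area
     they span, so N / D is the tangent of the clockwise turn. *)
  set (N := fun s => cos (phi s) * sin (phi s) * (/ c - c)).
  set (D := fun s => c * (cos (phi s) * cos (phi s)) + / c * (sin (phi s) * sin (phi s))).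
  assert (HD : forall s, 0 < D s).
  { intros s; unfold D. pose proof (sin2_cos2 (phi s)) as E; unfold Rsqr in E.
    pose proof (Rle_0_sqr (sin (phi s))); pose proof (Rle_0_sqr (cos (phi s))); unfold Rsqr in *.
    destruct (Rle_lt_dec (1 / 2) (cos (phi s) * cos (phi s))).
    - assert (0 < c * (cos (phi s) * cos (phi s))) by (apply Rmult_lt_0_compat; lra).
      assert (0 <= / c * (sin (phi s) * sin (phi s))) by (apply Rmult_le_pos; lra). lra.
    - assert (0 <= c * (cos (phi s) * cos (phi s))) by (apply Rmult_le_pos; lra).
      assert (0 < / c * (sin (phi s) * sin (phi s))) by (apply Rmult_lt_0_compat; lra). lra. }
  assert (Cc : continuity (fun s => cos (phi s))) by (apply (continuity_comp phi cos); auto; apply continuity_cos).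
  assert (Cs : continuity (fun s => sin (phi s))) by (apply (continuity_comp phi sin); auto; apply continuity_sin).
  assert (CN : continuity N).
  { apply (continuity_mult (fun s => cos (phi s) * sin (phi s)) (fun _ => / c - c)).
    - apply (continuity_mult (fun s => cos (phi s)) (fun s => sin (phi s))); auto.
    - apply continuity_const; now intros ? ?. }
  assert (CD : continuity D).
  { apply (continuity_plus (fun s => c * (cos (phi s) * cos (phi s)))
      (fun s => / c * (sin (phi s) * sin (phi s)))).
    - apply (continuity_scal (fun s => cos (phi s) * cos (phi s))).
      apply (continuity_mult (fun s => cos (phi s)) (fun s => cos (phi s))); auto.
    - apply (continuity_scal (fun s => sin (phi s) * sin (phi s))).
      apply (continuity_mult (fun s => sin (phi s)) (fun s => sin (phi s))); auto. }
  exists (fun s => phi s + atan (N s / D s)), (fun s => r s * D s * sqrt (1 + (N s / D s)²)).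
  assert (Hq : forall s, 0 < sqrt (1 + (N s / D s)²)).
  { intros s; apply sqrt_lt_R0. pose proof (Rle_0_sqr (N s / D s)); lra. }
  repeat split.
  - apply (continuity_plus phi (fun s => atan (N s / D s))); auto.
    apply (continuity_comp (fun s => N s / D s) atan).
    + apply (continuity_div N D); auto. intros s; specialize (HD s); lra.
    + intros y; apply derivable_continuous_pt, derivable_pt_atan.
  - intros s. repeat apply Rmult_lt_0_compat; auto.
  - intros s; rewrite H3; simpl. rewrite cos_plus, sin_plus, cos_atan, sin_atan.
    specialize (Hq s); specialize (HD s). set (q := sqrt _) in *.
    pose proof (sin2_cos2 (phi s)) as E; unfold Rsqr in E.
    f_equal.
    + transitivity (r s * (D s * cos (phi s) - N s * sin (phi s))); [|field; lra].
      unfold D, N.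
      replace (r s * ((c * (cos (phi s) * cos (phi s)) + / c * (sin (phi s) * sin (phi s))) *
        cos (phi s) - cos (phi s) * sin (phi s) * (/ c - c) * sin (phi s)))
      with (r s * c * cos (phi s) * (sin (phi s) * sin (phi s) + cos (phi s) * cos (phi s))) by ring.
      rewrite E; ring.
    + transitivity (- (r s * (D s * sin (phi s) + N s * cos (phi s)))); [|field; lra].
      unfold D, N.
      replace (r s * ((c * (cos (phi s) * cos (phi s)) + / c * (sin (phi s) * sin (phi s))) *
        sin (phi s) + cos (phi s) * sin (phi s) * (/ c - c) * cos (phi s)))
      with (r s * / c * sin (phi s) * (sin (phi s) * sin (phi s) + cos (phi s) * cos (phi s))) by ring.
      rewrite E; ring.
  - intros s Hs; specialize (H4 s Hs). pose proof (atan_bound (N s / D s)); lra.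
Qed.

Lemma winding_dil v a K c : c <> 0 -> winding v a K ->
  winding (fun s => (c * fst (v s), / c * snd (v s))) a (K + PI / 2).
Proof.
  intros Hc Hv. destruct (Rlt_or_le 0 c) as [Hp|Hp]; [now apply winding_dil_pos|].
  eapply winding_ext; [|apply winding_opp, (winding_dil_pos v a K (- c)); [lra|exact Hv]].
  intros s; simpl. f_equal; field; lra.
Qed.

(** The angle is continuous and tends to infinity, so every direction is met beyond any T. *)
Lemma winding_hits v a K T x : 0 < a -> winding v a K ->
  exists s rho, T < s /\ 0 < rho /\ v s = (rho * cos x, - (rho * sin x)).
Proof.
  intros Ha [phi [r [H1 [H2 [H3 H4]]]]].
  set (T0 := Rmax T 0 + 1).
  assert (HT : T < T0 /\ 0 < T0) by (unfold T0; pose proof (Rmax_l T 0); pose proof (Rmax_r T 0); lra).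
  pose proof PI_RGT_0 as HPI.
  (* The target y is a representative of x modulo 2 PI above phi T0, and T1 is so late that a * T1 -
     K has reached it. *)
  destruct (INR_unbounded ((phi T0 - x) / (2 * PI))) as [k Hk].
  assert (Hk' : phi T0 < x + 2 * INR k * PI).
  { apply (Rmult_lt_compat_r (2 * PI)) in Hk; [|lra].
    replace ((phi T0 - x) / (2 * PI) * (2 * PI)) with (phi T0 - x) in Hk by (field; lra). lra. }
  set (y := x + 2 * INR k * PI) in *.
  set (T1 := Rmax (T0 + 1) ((y + K) / a)).
  assert (HT1 : T0 < T1) by (unfold T1; pose proof (Rmax_l (T0 + 1) ((y + K) / a)); lra).
  assert (Hy : y <= phi T1).
  { apply Rle_trans with (a * T1 - K); [|apply H4; lra].
    pose proof (Rmax_r (T0 + 1) ((y + K) / a)) as Hm. fold T1 in Hm.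
    apply (Rmult_le_compat_l a) in Hm; [|lra].
    replace (a * ((y + K) / a)) with (y + K) in Hm by (field; lra). lra. }
  destruct (IVT_cor (fun s => phi s - y) T0 T1) as [s [Hs E]].
  - apply (continuity_minus phi (fun _ => y)); auto. apply continuity_const; now intros ? ?.
  - lra.
  - assert (0 <= (y - phi T0) * (phi T1 - y)) by (apply Rmult_le_pos; lra). lra.
  - exists s, (r s). repeat split; auto; [lra|].
    rewrite H3. replace (phi s) with y by lra. unfold y. now rewrite cos_period, sin_period.
Qed.

Lemma winding_const k : 0 < k -> forall t, winding (fun _ => (k * cos t, - (k * sin t))) 0 (- t).
Proof.
  intros Hk t. exists (fun _ => t), (fun _ => k); repeat split; auto.
  - apply continuity_const; now intros ? ?.
  - intros; lra.
Qed.

Definition trig_vec (v : R -> R * R) : Prop :=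
  is_trig (fun s => fst (v s)) /\ is_trig (fun s => snd (v s)).

Lemma trig_vec_rot l v : trig_vec v -> trig_vec (fun s => rmv (rot (l * s)) (v s)).
Proof.
  intros [H1 H2]; split; simpl.
  - eapply is_trig_ext; [|apply is_trig_plus;
      [apply (is_trig_mul_cos l 0 _ H1)|apply (is_trig_mul_cos l (- (PI / 2)) _ H2)]].
    intros s; simpl. rewrite Rplus_0_r, cos_plus, cos_neg, sin_neg, cos_PI2, sin_PI2; ring.
  - eapply is_trig_ext; [|apply is_trig_plus;
      [apply (is_trig_mul_cos l (PI / 2) _ H1)|apply (is_trig_mul_cos l 0 _ H2)]].
    intros s; simpl. rewrite Rplus_0_r, cos_plus, cos_PI2, sin_PI2; ring.
Qed.

Lemma trig_vec_dil c d v : trig_vec v -> trig_vec (fun s => (c * fst (v s), d * snd (v s))).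
Proof. intros [H1 H2]; split; simpl; now apply is_trig_scal. Qed.

(** * Eigenfunctions and Cauchy data *)

Definition sol (s : R) (v : R * R) (x : R) : R := fst (rmv (rot (x * s)) v).

(* w j is the Cauchy data (f, f'/s) at the start of edge j. *)
Definition vsol (n : nat) (alpha ell : nat -> R) (s : R) (w : nat -> R * R) : Prop :=
  forall j, (j < n)%nat ->
    let v := rmv (rot (ell j * s)) (w j) in
    sin (theta (alpha j)) * fst (w (S j mod n)%nat) = cos (theta (alpha j)) * fst v /\
    cos (theta (alpha j)) * snd (w (S j mod n)%nat) = sin (theta (alpha j)) * snd v.

Lemma derivable_cos_scaled s x : derivable_pt_lim (fun x => cos (x * s)) x (- s * sin (x * s)).
Proof.
  replace (- s * sin (x * s)) with (- sin (x * s) * (1 * s + x * 0)) by ring.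
  apply (derivable_pt_lim_comp (fun x => x * s) cos).
  - apply (derivable_pt_lim_mult id (fun _ => s)); [apply derivable_pt_lim_id|apply derivable_pt_lim_const].
  - apply derivable_pt_lim_cos.
Qed.

Lemma derivable_sin_scaled s x : derivable_pt_lim (fun x => sin (x * s)) x (s * cos (x * s)).
Proof.
  replace (s * cos (x * s)) with (cos (x * s) * (1 * s + x * 0)) by ring.
  apply (derivable_pt_lim_comp (fun x => x * s) sin).
  - apply (derivable_pt_lim_mult id (fun _ => s)); [apply derivable_pt_lim_id|apply derivable_pt_lim_const].
  - apply derivable_pt_lim_sin.
Qed.

Lemma derivable_ext f g x l l' : (forall y, f y = g y) -> l = l' ->
  derivable_pt_lim f x l -> derivable_pt_lim g x l'.
Proof. intros E <- H eps He. destruct (H eps He) as [d Hd]. exists d; intros; rewrite <- !E; auto. Qed.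

Lemma derivable_comb s a b x :
  derivable_pt_lim (fun x => a * cos (x * s) + b * sin (x * s)) x
    (s * (- a * sin (x * s) + b * cos (x * s))).
Proof.
  eapply derivable_ext; [intros; reflexivity| |
   apply (derivable_pt_lim_plus (fun x => a * cos (x * s)) (fun x => b * sin (x * s)));
   [apply (derivable_pt_lim_scal (fun x => cos (x * s))), derivable_cos_scaled
   |apply (derivable_pt_lim_scal (fun x => sin (x * s))), derivable_sin_scaled]].
  ring.
Qed.

Lemma vsol_eigfun n alpha ell s w : vsol n alpha ell s w ->
  graph_eigfun n alpha ell (s ^ 2) (fun j => sol s (w j)).
Proof.
  intros Hw.
  exists (fun j x => s * snd (rmv (rot (x * s)) (w j))), (fun j x => - (s ^ 2 * sol s (w j) x)).
  split.
  - intros j Hj x _. destruct (w j) as [a b]. unfold sol; simpl. repeat split.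
    + eapply derivable_ext; [| |apply (derivable_comb s a b)]; [intros; simpl; ring|ring].
    + eapply derivable_ext; [| |apply (derivable_comb s (s * b) (- s * a))]; [intros; simpl; ring|ring].
    + ring.
  - intros j Hj th. fold (theta (alpha j)) in th. destruct (Hw j Hj) as [H1 H2].
    unfold sol. rewrite Rmult_0_l. unfold th. cbv zeta in H1, H2.
    replace (rmv (rot 0) (w (S j mod n)%nat)) with (w (S j mod n)%nat).
    + split; [exact H1|].
      replace (cos (theta (alpha j)) * (s * snd (w (S j mod n)%nat)))
        with (s * (cos (theta (alpha j)) * snd (w (S j mod n)%nat))) by ring.
      rewrite H2; ring.
    + destruct (w (S j mod n)%nat); simpl; rewrite cos_0, sin_0; f_equal; ring.
Qed.

Lemma constant_of_deriv0 f b x : (forall c, 0 <= c <= b -> derivable_pt_lim f c 0) ->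
  0 <= x <= b -> f x = f 0.
Proof.
  intros H Hx. destruct (Req_dec x 0) as [->|Hne]; auto.
  destruct (MVT_cor2 f (fun _ => 0) 0 x) as [c [E _]]; [lra|intros; apply H; lra|lra].
Qed.

(** The Cauchy data rotated back to the start of the edge have zero derivative, hence are
    constant. *)
Lemma oscillator_solution s b f f1 f2 : 0 < s ->
  (forall x, 0 <= x <= b -> derivable_pt_lim f x (f1 x) /\ derivable_pt_lim f1 x (f2 x) /\
     - f2 x = s ^ 2 * f x) ->
  forall x, 0 <= x <= b -> (f x, f1 x / s) = rmv (rot (x * s)) (f 0, f1 0 / s).
Proof.
  intros Hs H x Hx.
  assert (E1 : cos (x * s) * f x - sin (x * s) * (/ s * f1 x) = f 0).
  { rewrite (constant_of_deriv0 (fun x => cos (x * s) * f x - sin (x * s) * (/ s * f1 x)) b x); auto.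
    - rewrite Rmult_0_l, cos_0, sin_0; ring.
    - intros c Hc. destruct (H c Hc) as [H1 [H2 H3]].
      eapply derivable_ext; [intros; reflexivity| |
        apply (derivable_pt_lim_minus (fun x => cos (x * s) * f x) (fun x => sin (x * s) * (/ s * f1 x)));
        [apply (derivable_pt_lim_mult (fun x => cos (x * s)) f); [apply derivable_cos_scaled|exact H1]
        |apply (derivable_pt_lim_mult (fun x => sin (x * s)) (fun x => / s * f1 x));
          [apply derivable_sin_scaled|apply derivable_pt_lim_scal, H2]]].
      simpl. replace (f2 c) with (- (s ^ 2 * f c)) by lra. field; lra. }
  assert (E2 : sin (x * s) * f x + cos (x * s) * (/ s * f1 x) = / s * f1 0).
  { rewrite (constant_of_deriv0 (fun x => sin (x * s) * f x + cos (x * s) * (/ s * f1 x)) b x); auto.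
    - rewrite Rmult_0_l, cos_0, sin_0; ring.
    - intros c Hc. destruct (H c Hc) as [H1 [H2 H3]].
      eapply derivable_ext; [intros; reflexivity| |
        apply (derivable_pt_lim_plus (fun x => sin (x * s) * f x) (fun x => cos (x * s) * (/ s * f1 x)));
        [apply (derivable_pt_lim_mult (fun x => sin (x * s)) f); [apply derivable_sin_scaled|exact H1]
        |apply (derivable_pt_lim_mult (fun x => cos (x * s)) (fun x => / s * f1 x));
          [apply derivable_cos_scaled|apply derivable_pt_lim_scal, H2]]].
      simpl. replace (f2 c) with (- (s ^ 2 * f c)) by lra. field; lra. }
  rewrite <- (rmv_radj (rot (x * s)) (f x, f1 x / s)) by apply rdet_rot.
  f_equal. simpl. unfold Rdiv. rewrite (Rmult_comm (f1 x)), (Rmult_comm (f1 0)).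
  f_equal; [rewrite <- E1 at 1|rewrite <- E2]; ring.
Qed.

Lemma cyclic_monotone_constant n (q : nat -> R) :
  (forall j, (j < n)%nat -> q j <= q (S j mod n)%nat) ->
  forall j, (j < n)%nat -> q (S j mod n)%nat = q j.
Proof.
  intros H.
  assert (Hs : forall j, (S j < n)%nat -> q j <= q (S j)).
  { intros j Hj. specialize (H j ltac:(lia)). rewrite Nat.mod_small in H by lia. auto. }
  assert (Hle : forall i j, (i <= j)%nat -> (j < n)%nat -> q i <= q j).
  { intros i j Hij; induction Hij; intros Hj; [lra|].
    specialize (IHHij ltac:(lia)); specialize (Hs m Hj); lra. }
  assert (Hc : forall j, (j < n)%nat -> q j = q 0%nat).
  { intros j Hj. apply Rle_antisym; [|apply Hle; lia].
    apply Rle_trans with (q (n - 1)%nat); [apply Hle; lia|].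
    specialize (H (n - 1)%nat ltac:(lia)).
    replace (S (n - 1)) with n in H by lia. rewrite Nat.Div0.mod_same in H. auto. }
  intros j Hj. rewrite (Hc j Hj). apply Hc, Nat.mod_upper_bound; lia.
Qed.

(** Multiply the two conditions and cancel sin * cos; if one of these factors is zero, both fluxes
    vanish. *)
Lemma matching_flux th a a' b b' : sin th * a = cos th * b -> cos th * a' = sin th * b' ->
  a * a' = b * b'.
Proof.
  intros H1 H2. pose proof (sin2_cos2 th) as E; unfold Rsqr in E.
  destruct (Req_dec (sin th) 0) as [Es|Es].
  - rewrite Es in *. assert (cos th <> 0) by nra.
    assert (b = 0) by (apply (Rmult_eq_reg_l (cos th)); lra).
    assert (a' = 0) by (apply (Rmult_eq_reg_l (cos th)); lra). subst; ring.
  - destruct (Req_dec (cos th) 0) as [Ec|Ec].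
    + rewrite Ec in *. assert (a = 0) by (apply (Rmult_eq_reg_l (sin th)); lra).
      assert (b' = 0) by (apply (Rmult_eq_reg_l (sin th)); lra). subst; ring.
    + apply (Rmult_eq_reg_l (sin th * cos th)); [|apply Rmult_integral_contrapositive; auto].
      replace (sin th * cos th * (a * a')) with ((sin th * a) * (cos th * a')) by ring.
      rewrite H1, H2; ring.
Qed.

(* The flux f f' has derivative f'^2 - nu f^2 >= 0 on edges and is preserved at
   vertices; going once around the cycle forces it to be constant. *)
Lemma eigfun_nonpos n alpha ell nu f : (forall j, (j < n)%nat -> 0 < ell j) -> nu <= 0 ->
  graph_eigfun n alpha ell nu f ->
  on_graph n ell (fun j x => f j x = f j 0 /\ (nu < 0 -> f j x = 0)).
Proof.
  intros Hell Hnu [f1 [f2 [Hd Hm]]].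
  assert (Hp : forall j, (j < n)%nat -> forall x, 0 <= x <= ell j ->
    derivable_pt_lim (fun x => f j x * f1 j x) x (f1 j x * f1 j x - nu * (f j x * f j x))).
  { intros j Hj x Hx. destruct (Hd j Hj x Hx) as [H1 [H2 H3]].
    eapply derivable_ext; [intros; reflexivity| |apply (derivable_pt_lim_mult (f j) (f1 j)); eauto].
    replace (f2 j x) with (- (nu * f j x)) by lra. ring. }
  assert (Hpos : forall a b, 0 <= a * a - nu * (b * b)).
  { intros a b. pose proof (Rle_0_sqr a); pose proof (Rle_0_sqr b); unfold Rsqr in *.
    assert (0 <= - nu * (b * b)) by (apply Rmult_le_pos; lra). lra. }
  assert (Hmon : forall j, (j < n)%nat -> forall x y, 0 <= x -> x <= y -> y <= ell j ->
    f j x * f1 j x <= f j y * f1 j y).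
  { intros j Hj x y H0 Hxy Hy. destruct (Req_dec x y) as [->|Hne]; [lra|].
    destruct (MVT_cor2 (fun x => f j x * f1 j x)
      (fun x => f1 j x * f1 j x - nu * (f j x * f j x)) x y) as [c [E Hc]]; [lra| |].
    - intros; apply Hp; auto; lra.
    - specialize (Hpos (f1 j c) (f j c)).
      assert (0 <= (f1 j c * f1 j c - nu * (f j c * f j c)) * (y - x)) by (apply Rmult_le_pos; lra).
      lra. }
  assert (Hv : forall j, (j < n)%nat ->
    f (S j mod n)%nat 0 * f1 (S j mod n)%nat 0 = f j (ell j) * f1 j (ell j)).
  { intros j Hj; destruct (Hm j Hj); eapply matching_flux; eauto. }
  assert (Hc : forall j, (j < n)%nat -> f j (ell j) * f1 j (ell j) = f j 0 * f1 j 0).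
  { intros j Hj. rewrite <- Hv by auto.
    apply (cyclic_monotone_constant n (fun j => f j 0 * f1 j 0)); auto.
    intros i Hi. rewrite Hv by auto. specialize (Hell i Hi). apply Hmon; auto; lra. }
  intros j Hj.
  assert (Hint : forall x, 0 < x < ell j -> f1 j x * f1 j x - nu * (f j x * f j x) = 0).
  { intros x Hx. specialize (Hp j Hj x ltac:(lra)).
    set (pr := exist _ _ Hp : derivable_pt (fun x => f j x * f1 j x) x).
    transitivity (derive_pt (fun x => f j x * f1 j x) x pr); [reflexivity|].
    (* The flux is monotone with equal values at both ends, hence constant, so every interior point
       is a maximum. *)
    apply (deriv_maximum _ 0 (ell j)); [lra|lra|].
    intros y Hy. specialize (Hc j Hj).
    pose proof (Hmon j Hj y (ell j)); pose proof (Hmon j Hj 0 x); lra. }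
  assert (Hf1 : forall x, 0 < x < ell j -> f1 j x = 0 /\ (nu < 0 -> f j x = 0)).
  { intros x Hx. specialize (Hint x Hx).
    pose proof (Rle_0_sqr (f1 j x)); pose proof (Rle_0_sqr (f j x)); unfold Rsqr in *.
    assert (0 <= - nu * (f j x * f j x)) by (apply Rmult_le_pos; lra).
    split; [assert (E : f1 j x * f1 j x = 0) by lra; apply Rmult_integral in E; lra|]. intros Hn.
    assert (nu * (f j x * f j x) = 0) by lra.
    apply Rmult_integral in H2 as [|H2]; [lra|]. apply Rmult_integral in H2; lra. }
  assert (Hconst : forall x, 0 <= x <= ell j -> f j x = f j 0).
  { intros x Hx. destruct (Req_dec x 0) as [->|Hne]; auto.
    destruct (MVT_cor2 (f j) (f1 j) 0 x) as [c [E Hcx]]; [lra|intros; apply (Hd j Hj); lra|].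
    destruct (Hf1 c ltac:(lra)) as [E1 _]. rewrite E1 in E; lra. }
  specialize (Hell j Hj). intros x Hx; split; auto. intros Hn.
  rewrite Hconst by auto. rewrite <- (Hconst (ell j / 2)) by lra.
  apply Hf1; auto; lra.
Qed.

(** At s = 0 there is no quotient f'/s. There f is constant on edges by [eigfun_nonpos] and the
    datum is (f, 0), which the last clause records. *)
Lemma eigfun_vsol n alpha ell s f : (forall j, (j < n)%nat -> 0 < ell j) -> 0 <= s ->
  graph_eigfun n alpha ell (s ^ 2) f ->
  exists w, vsol n alpha ell s w /\ on_graph n ell (fun j x => f j x = sol s (w j) x) /\
    (s = 0 -> forall j, snd (w j) = 0).
Proof.
  intros Hell Hs Hf. destruct (Req_dec s 0) as [->|Hne].
  - assert (Hz := eigfun_nonpos n alpha ell (0 ^ 2) f Hell ltac:(simpl; lra) Hf).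
    destruct Hf as [f1 [f2 [_ Hm]]].
    exists (fun j => (f j 0, 0)); split; [|split; [|auto]].
    + intros j Hj; destruct (Hm j Hj) as [H1 _].
      destruct (Hz j Hj (ell j)) as [E _]; [specialize (Hell j Hj); lra|].
      rewrite E in H1. simpl. rewrite Rmult_0_r, cos_0, sin_0. fold (theta (alpha j)) in H1. lra.
    + intros j Hj x Hx. destruct (Hz j Hj x Hx) as [E _]. rewrite E.
      unfold sol; simpl. rewrite Rmult_0_r, cos_0, sin_0; ring.
  - destruct Hf as [f1 [f2 [Hd Hm]]].
    assert (Ho : forall j, (j < n)%nat -> forall x, 0 <= x <= ell j ->
      (f j x, f1 j x / s) = rmv (rot (x * s)) (f j 0, f1 j 0 / s)).
    { intros j Hj. apply (oscillator_solution s (ell j) _ _ (f2 j)); [lra|].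
      intros; apply Hd; auto. }
    exists (fun j => (f j 0, f1 j 0 / s)); split; [|split; [|intros; lra]].
    + intros j Hj. cbv zeta. specialize (Hell j Hj). rewrite <- Ho by (auto; lra).
      destruct (Hm j Hj) as [H1 H2]. fold (theta (alpha j)) in H1, H2. split; [exact H1|].
      simpl snd. unfold Rdiv. rewrite <- !Rmult_assoc. now rewrite H2.
    + intros j Hj x Hx. unfold sol. rewrite <- Ho; auto.
Qed.

Lemma sol_nonzero s v l : 0 < s -> 0 < l -> (forall x, 0 <= x <= l -> sol s v x = 0) -> v = (0, 0).
Proof.
  intros Hs Hl H. destruct v as [a b]; unfold sol in H; simpl in H.
  pose proof (H 0 ltac:(lra)) as E. rewrite Rmult_0_l, cos_0, sin_0 in E.
  assert (a = 0) by lra; subst a.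
  (* This makes 0 < x * s <= 1 < PI, so the sine at x does not vanish. *)
  set (x := Rmin l (1 / s)).
  assert (H1s : 0 < 1 / s) by (apply Rdiv_lt_0_compat; lra).
  assert (Hx : 0 < x <= l) by (split; [apply Rmin_glb_lt; lra|apply Rmin_l]).
  assert (Hxs : x * s <= 1).
  { apply Rle_trans with (1 / s * s); [apply Rmult_le_compat_r; [lra|apply Rmin_r]|].
    right; field; lra. }
  specialize (H x ltac:(lra)).
  assert (0 < sin (x * s)).
  { apply sin_gt_0; [apply Rmult_lt_0_compat; lra|]. pose proof PI2_1; lra. }
  f_equal. apply (Rmult_eq_reg_r (sin (x * s))); lra.
Qed.

Lemma sol_zero_freq v x : sol 0 v x = fst v.
Proof. unfold sol; destruct v; simpl. rewrite Rmult_0_r, cos_0, sin_0; ring. Qed.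

(** * Plane-wave amplitudes and fixed spaces *)

Ltac pairs := repeat match goal with |- (_, _) = (_, _) => apply (f_equal2 pair) end.

(* Conjugates a real 2x2 matrix acting on (f, f'/s) to the basis of amplitudes
   of the plane waves exp(i s x), exp(-i s x), up to phases exp(-+ i pi/4). *)
Definition toC (M : RMat) : Mat :=
  let '((a, b), (c, d)) := M in
  ((((a + d) / 2, (b - c) / 2), (- (b + c) / 2, - (a - d) / 2)),
   ((- (b + c) / 2, (a - d) / 2), ((a + d) / 2, - (b - c) / 2))).

(* The amplitudes of the complex Cauchy data u + i w. *)
Definition toV (u w : R * R) : Vec :=
  (((fst u - snd u) / 2 + (fst w + snd w) / 2, - (fst u + snd u) / 2 + (fst w - snd w) / 2),
   ((fst u - snd u) / 2 - (fst w + snd w) / 2, (fst u + snd u) / 2 + (fst w - snd w) / 2)).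

Lemma toC_mul A B : mmul (toC A) (toC B) = toC (rmm A B).
Proof.
  destruct A as [[a b] [c d]], B as [[e f] [g h]]; unfold mmul, toC, rmm, Cadd, Cmul; simpl.
  pairs; field.
Qed.

Lemma toC_id : mid = toC rid.
Proof. unfold mid, toC, rid, Cr, C0; pairs; field. Qed.

Lemma toC_rot l s : Bmat l s = toC (rot (l * s)).
Proof.
  unfold Bmat, toC, rot, Cexpi, C0. rewrite cos_neg, sin_neg. pairs; field.
Qed.

Lemma sin_INR_PI k : sin (INR k * PI) = 0.
Proof. apply sin_eq_0_1. exists (Z.of_nat k). now rewrite INR_IZR_INZ. Qed.

(** [2 * theta a] equals PI^2 / (2 a), which is a multiple of PI exactly when a = PI / (2 k). *)
Lemma nonexceptional_theta a : 0 < a -> ~ exceptional a ->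
  sin (theta a) <> 0 /\ cos (theta a) <> 0.
Proof.
  intros Ha Hn. pose proof PI_RGT_0 as HPI.
  enough (H : sin (2 * theta a) <> 0).
  { rewrite sin_2a in H. split; intros E; apply H; rewrite E; ring. }
  intros E. apply Hn. apply sin_eq_0_0 in E as [k Hk]. unfold theta in Hk.
  assert (Hk2 : PI = 2 * a * IZR k).
  { apply (Rmult_eq_reg_r PI); [|lra]. rewrite (Rmult_assoc (2 * a)), <- Hk. field; lra. }
  assert (Hkp : (0 < k)%Z).
  { apply lt_IZR. apply (Rmult_lt_reg_l (2 * a)); lra. }
  exists (Z.to_nat k). split; [lia|].
  rewrite INR_IZR_INZ, Z2Nat.id by lia. apply IZR_lt in Hkp.
  rewrite Hk2 at 1. field; lra.
Qed.

Lemma exceptional_theta a k : (1 <= k)%nat -> a = PI / (2 * INR k) ->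
  if Nat.even k then sin (theta a) = 0 /\ cos (theta a) <> 0
  else cos (theta a) = 0 /\ sin (theta a) <> 0.
Proof.
  intros Hk ->. pose proof PI_RGT_0 as HPI.
  assert (Hp : 0 < INR k) by (apply lt_0_INR; lia).
  assert (E : theta (PI / (2 * INR k)) = INR k * (PI / 2)) by (unfold theta; field; lra).
  rewrite E.
  pose proof (sin2_cos2 (INR k * (PI / 2))) as Eq; unfold Rsqr in Eq.
  destruct (Nat.even k) eqn:Ek.
  - apply Nat.even_spec in Ek as [m ->].
    assert (Es : sin (INR (2 * m) * (PI / 2)) = 0).
    { rewrite mult_INR. replace (INR 2 * INR m * (PI / 2)) with (INR m * PI) by (simpl; field).
      apply sin_INR_PI. }
    split; auto. intros Ec. rewrite Es, Ec in Eq; lra.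
  - rewrite <- Nat.negb_odd, Bool.negb_false_iff in Ek. apply Nat.odd_spec in Ek as [m ->].
    assert (Ec : cos (INR (2 * m + 1) * (PI / 2)) = 0).
    { rewrite plus_INR, mult_INR.
      replace ((INR 2 * INR m + INR 1) * (PI / 2)) with (PI / 2 + INR m * PI) by (simpl; field).
      rewrite cos_plus, cos_PI2, sin_INR_PI; ring. }
    split; auto. intros Es. rewrite Es, Ec in Eq; lra.
Qed.

(** Double-angle formulas: csc 2t = (cot t + tan t) / 2 and cot 2t = (cot t - tan t) / 2. *)
Lemma toC_vmat a : 0 < a -> ~ exceptional a -> Amat a = toC (vmat a).
Proof.
  intros Ha Hn. destruct (nonexceptional_theta a Ha Hn) as [Hs Hc].
  unfold Amat. replace (PI ^ 2 / (2 * a)) with (2 * theta a) by (unfold theta; field; lra).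
  rewrite sin_2a, cos_2a. unfold toC, vmat, Cr.
  pose proof (sin2_cos2 (theta a)) as E; unfold Rsqr in E.
  set (S := sin (theta a)) in *; set (K := cos (theta a)) in *.
  assert (E1 : / (2 * S * K) = (K / S + S / K) / 2).
  { replace ((K / S + S / K) / 2) with ((S * S + K * K) / (2 * S * K)) by (field; auto).
    rewrite E; field; auto. }
  rewrite E1. pairs; field; auto.
Qed.

Lemma toC_toV M u w : mvec (toC M) (toV u w) = toV (rmv M u) (rmv M w).
Proof.
  destruct M as [[a b] [c d]], u as [u1 u2], w as [w1 w2].
  unfold mvec, toC, toV, rmv, Cadd, Cmul; simpl. pairs; field.
Qed.

Lemma toV_inj u w u' w' : toV u w = toV u' w' -> u = u' /\ w = w'.
Proof.
  destruct u as [a b], w as [c d], u' as [a' b'], w' as [c' d']; unfold toV; simpl.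
  intros H; injection H; intros; split; f_equal; lra.
Qed.

Lemma toV_surj v : exists u w, v = toV u w.
Proof.
  destruct v as [[a b] [c d]].
  exists ((a + c + d - b) / 2, (d - b - a - c) / 2), ((a - c + b + d) / 2, (a - c - b - d) / 2).
  unfold toV; simpl. pairs; field.
Qed.

Lemma toV_zero : toV (0, 0) (0, 0) = V0.
Proof. unfold toV, V0, C0; simpl. pairs; field. Qed.

(** Real and imaginary parts are fixed separately, so the complex fixed space of [toC M] is the
    complexification of the real one of M. *)
Lemma fixed_toV M u w : mvec (toC M) (toV u w) = toV u w <-> rmv M u = u /\ rmv M w = w.
Proof.
  rewrite toC_toV. split; [apply toV_inj|]. intros [-> ->]; auto.
Qed.

(** * Dimensions of complex fixed spaces *)

Lemma vlincomb_zero m vs : vlincomb (repeat C0 m) vs = V0.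
Proof.
  revert vs; induction m; intros [|[[a b] [c d]] vs]; simpl; auto. rewrite IHm.
  unfold vadd, vscal, V0, C0, Cadd, Cmul; simpl. pairs; ring.
Qed.

Lemma cindep_prefix vs ws cs : cindep (vs ++ ws) -> length cs = length vs ->
  vlincomb cs vs = V0 -> Forall (fun c => c = C0) cs.
Proof.
  intros HI Hl Hz. specialize (HI (cs ++ repeat C0 (length ws))).
  assert (E : forall cs vs, length cs = length vs ->
    vlincomb (cs ++ repeat C0 (length ws)) (vs ++ ws) = vlincomb cs vs).
  { clear. induction cs; intros [|v vs] H; simpl in *; try lia; [apply vlincomb_zero|].
    rewrite IHcs; auto. }
  rewrite E in HI by auto. rewrite !length_app, repeat_length in HI.
  assert (HF := HI ltac:(lia) Hz). now apply Forall_app in HF.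
Qed.

Lemma cindep_head v vs : cindep (v :: vs) -> v <> V0.
Proof.
  intros HI ->. assert (H := cindep_prefix [V0] vs [Cr 1] HI eq_refl).
  assert (HF : Forall (fun c => c = C0) [Cr 1]).
  { apply H; simpl. unfold vadd, vscal, V0, C0, Cadd, Cmul; simpl. pairs; ring. }
  inversion HF as [|? ? E]. unfold Cr, C0 in E. injection E; lra.
Qed.

Lemma fixed_dim_0 M : (forall v, rmv M v = v -> v = (0, 0)) -> fixed_dim (toC M) 0.
Proof.
  intros H; split.
  - exists []; repeat split; auto. intros [|] Hl; [constructor|easy].
  - intros [|v vs] HF HI; [easy|]. exfalso. apply (cindep_head _ _ HI).
    apply Forall_inv in HF. destruct (toV_surj v) as [u [w ->]].
    apply fixed_toV in HF as [H1 H2]. rewrite (H u H1), (H w H2). apply toV_zero.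
Qed.

Lemma fixed_dim_1 M b : b <> (0, 0) -> rmv M b = b ->
  (forall v, rmv M v = v -> exists t, v = (t * fst b, t * snd b)) -> fixed_dim (toC M) 1.
Proof.
  intros Hb HM H; split.
  - exists [toV b (0, 0)]; repeat split.
    + constructor; [|constructor]. apply fixed_toV; split; auto.
      destruct M as [[p q] [r s]]; simpl; f_equal; ring.
    + intros [|[x y] [|]] Hl Hz; try easy. constructor; [|constructor].
      assert (E : toV (x * fst b, x * snd b) (y * fst b, y * snd b) = toV (0, 0) (0, 0)).
      { rewrite toV_zero, <- Hz. destruct b. unfold toV, vlincomb, vadd, vscal, V0, C0, Cadd, Cmul; simpl.
        pairs; field. }
      apply toV_inj in E as [E1 E2]. injection E1; injection E2; intros.
      assert (Hbb : fst b <> 0 \/ snd b <> 0).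
      { apply NNPP; intros Hn. apply Hb. destruct b; simpl in *. f_equal; apply NNPP; tauto. }
      unfold C0. destruct Hbb as [Hbb|Hbb]; f_equal; apply (Rmult_eq_reg_r _ _ _) with (2 := Hbb); lra.
  - intros [|v1 [|v2 vs]] HF HI; simpl; try lia. exfalso.
    pose proof (cindep_head _ _ HI) as Hv1.
    inversion HF as [|? ? F1 HF']; subst. inversion HF' as [|? ? F2 _]; subst.
    destruct (toV_surj v1) as [u1 [w1 ->]], (toV_surj v2) as [u2 [w2 ->]].
    apply fixed_toV in F1 as [F1 F1']. apply fixed_toV in F2 as [F2 F2'].
    destruct (H _ F1) as [a1 ->], (H _ F1') as [c1 ->], (H _ F2) as [a2 ->], (H _ F2') as [c2 ->].
    (* Both vectors are complex multiples of the one given by b, with factors z1 = a1 + i c1 and z2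
       = a2 + i c2; the relation is z2 v1 - z1 v2 = 0. *)
    assert (HZ := cindep_prefix [_; _] vs [(a2, c2); (- a1, - c1)] HI eq_refl).
    assert (HZ' : Forall (fun c => c = C0) [(a2, c2); (- a1, - c1)]).
    { apply HZ. destruct b. unfold toV, vlincomb, vadd, vscal, V0, C0, Cadd, Cmul; simpl.
      pairs; field. }
    inversion HZ' as [|? ? _ HZ2]; inversion HZ2 as [|? ? E _]. injection E; intros.
    apply Hv1. rewrite <- toV_zero.
    replace a1 with 0 by lra; replace c1 with 0 by lra. f_equal; f_equal; ring.
Qed.

Lemma Cmul_eq0_neg a : Cmul (Cr (-1)) a = C0 -> a = C0.
Proof.
  destruct a as [x y]; unfold Cmul, Cr, C0; simpl; intros H; injection H; intros; f_equal; lra.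
Qed.

(** Cramer's relation det(v2,v3) v1 + det(v3,v1) v2 + det(v1,v2) v3 = 0 forces det(v1,v2) = 0. Then
    v1 and v2 satisfy relations in which v2 has coefficient minus a coordinate of v1, so v1 = 0. *)
Lemma cindep_length_2 vs : cindep vs -> (length vs <= 2)%nat.
Proof.
  destruct vs as [|v1 [|v2 [|v3 vs]]]; simpl; try lia. intros HI; exfalso.
  pose proof (cindep_head _ _ HI) as Hv1.
  set (cross := fun u v : Vec => Cadd (Cmul (fst u) (snd v)) (Cmul (Cr (-1)) (Cmul (snd u) (fst v)))).
  assert (H3 := cindep_prefix [v1; v2; v3] vs [cross v2 v3; cross v3 v1; cross v1 v2] HI eq_refl).
  assert (E12 : cross v1 v2 = C0).
  { assert (HF : Forall (fun c => c = C0) [cross v2 v3; cross v3 v1; cross v1 v2]).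
    { apply H3. destruct v1 as [[? ?] [? ?]], v2 as [[? ?] [? ?]], v3 as [[? ?] [? ?]].
      unfold cross, vlincomb, vadd, vscal, V0, C0, Cadd, Cmul, Cr; simpl. pairs; ring. }
    inversion HF as [|? ? _ HF2]; inversion HF2 as [|? ? _ HF3]; now inversion HF3. }
  assert (Hz : forall c1 c2, vlincomb [c1; c2] [v1; v2] = V0 -> c2 = C0).
  { intros c1 c2 Hz. assert (HF := cindep_prefix [v1; v2] (v3 :: vs) [c1; c2] HI eq_refl Hz).
    inversion HF as [|? ? _ HF2]; now inversion HF2. }
  assert (Z1 : fst v1 = C0).
  { apply Cmul_eq0_neg, (Hz (fst v2)).
    destruct v1 as [[a b] [c d]], v2 as [[e f] [g h]].
    unfold cross, C0, Cadd, Cmul, Cr in E12; simpl in E12; injection E12; intros.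
    unfold vlincomb, vadd, vscal, V0, C0, Cadd, Cmul, Cr; simpl. pairs; lra. }
  assert (Z2 : snd v1 = C0).
  { apply Cmul_eq0_neg, (Hz (snd v2)).
    destruct v1 as [[a b] [c d]], v2 as [[e f] [g h]].
    unfold cross, C0, Cadd, Cmul, Cr in E12; simpl in E12; injection E12; intros.
    unfold vlincomb, vadd, vscal, V0, C0, Cadd, Cmul, Cr; simpl. pairs; lra. }
  apply Hv1. destruct v1; simpl in *; subst; auto.
Qed.

Lemma fixed_dim_2 : fixed_dim (toC rid) 2.
Proof.
  split; [|intros; now apply cindep_length_2].
  exists [(Cr 1, C0); (C0, Cr 1)]; repeat split.
  - rewrite <- toC_id. unfold mid. repeat constructor;
    unfold mvec, C0, Cadd, Cmul, Cr; simpl; pairs; ring.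
  - intros [|[x y] [|[z t] [|]]] Hl Hz; try easy.
    unfold vlincomb, vadd, vscal, V0, C0, Cadd, Cmul, Cr in Hz; simpl in Hz.
    injection Hz; intros. unfold C0. repeat constructor; f_equal; lra.
Qed.

Lemma has_eig1_toC M : has_eig1 (toC M) <-> exists v, v <> (0, 0) /\ rmv M v = v.
Proof.
  split.
  - intros [v [Hv HM]]. destruct (toV_surj v) as [u [w ->]]. apply fixed_toV in HM as [Hu Hw].
    destruct (classic (u = (0, 0))) as [->|Hne]; [|eauto].
    exists w; split; auto. intros ->. apply Hv, toV_zero.
  - intros [v [Hv HM]]. exists (toV v (0, 0)); split.
    + rewrite <- toV_zero. intros E; apply toV_inj in E; tauto.
    + apply fixed_toV; split; auto. destruct M as [[p q] [r s]]; simpl; f_equal; ring.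
Qed.

Lemma rmv_id v : rmv rid v = v.
Proof. destruct v; simpl; f_equal; ring. Qed.

(** det(M - 1) = 2 - tr M when det M = 1. The two combinations of equations are the rows of the
    adjugate of M - 1. *)
Lemma fixed_trace M v : rdet M = 1 -> v <> (0, 0) -> rmv M v = v -> rtr M = 2.
Proof.
  destruct M as [[a b] [c d]], v as [x y]; simpl. intros Hd Hv HM; injection HM; intros E1 E2.
  apply NNPP; intros Hn. apply Hv.
  assert (H1 : (2 - (a + d)) * x = 0).
  { replace ((2 - (a + d)) * x) with
      ((d - 1) * (a * x + b * y - x) - b * (c * x + d * y - y) + (1 - (a * d - b * c)) * x) by ring.
    rewrite Hd, E2, E1; ring. }
  assert (H2 : (2 - (a + d)) * y = 0).
  { replace ((2 - (a + d)) * y) with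
      ((a - 1) * (c * x + d * y - y) - c * (a * x + b * y - x) + (1 - (a * d - b * c)) * y) by ring.
    rewrite Hd, E2, E1; ring. }
  apply Rmult_integral in H1, H2. f_equal; lra.
Qed.

Lemma fixed_line M : rdet M = 1 -> rtr M = 2 -> M <> rid ->
  exists b, b <> (0, 0) /\ rmv M b = b /\
    forall v, rmv M v = v -> exists t, v = (t * fst b, t * snd b).
Proof.
  destruct M as [[a b] [c d]]; simpl. intros Hd Ht Hn.
  assert (d = 2 - a) by lra; subst d.
  assert (Hq : (a - 1) * (a - 1) = - (b * c)) by lra.
  destruct (Req_dec b 0) as [->|Hb].
  - assert (Ha : a = 1).
    { assert (H : (a - 1) * (a - 1) = 0) by lra. apply Rmult_integral in H; lra. }
    subst a. assert (Hc : c <> 0).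
    { intros ->; apply Hn; unfold rid; pairs; lra. }
    exists (0, 1); split; [|split].
    + intros E; injection E; lra.
    + simpl; f_equal; ring.
    + intros [x y] E; simpl in E; injection E; intros. exists y; simpl; f_equal; [|ring].
      apply (Rmult_eq_reg_l c); auto; lra.
  (* This vector spans the kernel of the first row (a - 1, b) of M - 1; the second row follows from
     (a - 1)^2 = - b c. *)
  - exists (- b, a - 1); split; [|split].
    + intros E; injection E; lra.
    + simpl; f_equal; lra.
    + intros [x y] E; simpl in E; injection E; intros E1 E2. exists (- x / b); simpl; f_equal.
      * field; auto.
      * apply (Rmult_eq_reg_l b); auto. field_simplify; auto. lra.
Qed.

(** * Real monodromy around the cycle *)

(** Carries data from the start of edge 0 to the start of edge k; k = n gives the monodromy. *)
Fixpoint Tr (alpha ell : nat -> R) (s : R) (k : nat) : RMat :=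
  match k with
  | O => rid
  | S k' => rmm (rmm (vmat (alpha k')) (rot (ell k' * s))) (Tr alpha ell s k')
  end.

Lemma Tprod_toC alpha ell s k :
  (forall j, (j < k)%nat -> 0 < alpha j /\ ~ exceptional (alpha j)) ->
  Tprod alpha ell s k = toC (Tr alpha ell s k).
Proof.
  induction k; intros H; cbn [Tprod Tr]; [apply toC_id|].
  destruct (H k ltac:(lia)) as [Hp Hn].
  rewrite IHk, toC_vmat, toC_rot, !toC_mul; auto.
Qed.

Lemma rdet_vmat a : 0 < a -> ~ exceptional a -> rdet (vmat a) = 1.
Proof.
  intros Ha Hn. destruct (nonexceptional_theta a Ha Hn). simpl. field; auto.
Qed.

Lemma rdet_Tr alpha ell s k :
  (forall j, (j < k)%nat -> 0 < alpha j /\ ~ exceptional (alpha j)) ->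
  rdet (Tr alpha ell s k) = 1.
Proof.
  induction k; intros H; cbn [Tr]; [simpl; ring|].
  destruct (H k ltac:(lia)) as [Hp Hn].
  rewrite !rdet_rmm, IHk, rdet_vmat, rdet_rot; auto; ring.
Qed.

Lemma matching_vmat a x y : 0 < a -> ~ exceptional a ->
  (sin (theta a) * fst x = cos (theta a) * fst y /\
   cos (theta a) * snd x = sin (theta a) * snd y) <-> x = rmv (vmat a) y.
Proof.
  intros Ha Hn. destruct (nonexceptional_theta a Ha Hn) as [Hs Hc].
  destruct x as [x1 x2], y as [y1 y2]; simpl.
  set (S := sin (theta a)) in *; set (K := cos (theta a)) in *. split.
  - intros [H1 H2]. f_equal.
    + apply (Rmult_eq_reg_l S); auto. rewrite H1; field; auto.
    + apply (Rmult_eq_reg_l K); auto. rewrite H2; field; auto.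
  - intros H; injection H; intros -> ->. split; field; auto.
Qed.

Lemma vsol_Tr n alpha ell s w : (1 <= n)%nat ->
  (forall j, (j < n)%nat -> 0 < alpha j /\ ~ exceptional (alpha j)) ->
  vsol n alpha ell s w ->
  (forall j, (j < n)%nat -> w j = rmv (Tr alpha ell s j) (w 0%nat)) /\
  rmv (Tr alpha ell s n) (w 0%nat) = w 0%nat.
Proof.
  intros Hn H Hw.
  assert (Hstep : forall j, (j < n)%nat ->
    w (S j mod n)%nat = rmv (rmm (vmat (alpha j)) (rot (ell j * s))) (w j)).
  { intros j Hj. destruct (H j Hj) as [Hp He]. rewrite rmv_rmm.
    apply matching_vmat; auto. }
  assert (Hj : forall j, (j < n)%nat -> w j = rmv (Tr alpha ell s j) (w 0%nat)).
  { induction j; intros Hj; [symmetry; apply rmv_id|].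
    specialize (Hstep j ltac:(lia)). rewrite Nat.mod_small in Hstep by lia.
    rewrite Hstep, IHj by lia. cbn [Tr]. now rewrite <- rmv_rmm. }
  split; auto. specialize (Hstep (n - 1)%nat ltac:(lia)).
  replace (S (n - 1)) with n in Hstep by lia. rewrite Nat.Div0.mod_same in Hstep.
  rewrite Hstep at 2. rewrite (Hj (n - 1)%nat) by lia.
  replace n with (S (n - 1)) at 1 by lia. cbn [Tr]. now rewrite (rmv_rmm (rmm _ _)).
Qed.

Lemma Tr_vsol n alpha ell s v : (1 <= n)%nat ->
  (forall j, (j < n)%nat -> 0 < alpha j /\ ~ exceptional (alpha j)) ->
  rmv (Tr alpha ell s n) v = v -> vsol n alpha ell s (fun j => rmv (Tr alpha ell s j) v).
Proof.
  intros Hn H Hv j Hj. destruct (H j Hj) as [Hp He]. apply matching_vmat; auto.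
  rewrite <- !rmv_rmm. destruct (Nat.eq_dec (S j) n) as [E|E].
  - rewrite E at 1. rewrite Nat.Div0.mod_same. cbn [Tr]. rewrite rmv_id, <- Hv at 1.
    rewrite <- E. cbn [Tr]. rewrite !rmv_rmm; auto.
  - rewrite Nat.mod_small by lia. cbn [Tr]. rewrite !rmv_rmm; auto.
Qed.

Definition rsumv (k : nat) (a : nat -> R) (u : nat -> R * R) : R * R :=
  (rsum k (fun i => a i * fst (u i)), rsum k (fun i => a i * snd (u i))).

Lemma sol_rsumv s M k a u x :
  sol s (rmv M (rsumv k a u)) x = rsum k (fun i => a i * sol s (rmv M (u i)) x).
Proof.
  induction k; simpl.
  - unfold sol, rsumv; destruct M as [[p q] [r t]]; simpl; ring.
  - rewrite <- IHk. unfold sol, rsumv; destruct M as [[p q] [r t]]; simpl; ring.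
Qed.

(** An eigenfunction is determined by its data on edge 0, so the eigenspace is the fixed space of
    the monodromy, cut down at s = 0 to data with vanishing second coordinate. *)
Lemma gmult_waves n alpha ell s k u : (1 <= n)%nat -> 0 <= s ->
  (forall j, (j < n)%nat -> 0 < alpha j /\ ~ exceptional (alpha j)) ->
  (forall j, (j < n)%nat -> 0 < ell j) ->
  (forall i, (i < k)%nat -> rmv (Tr alpha ell s n) (u i) = u i) ->
  (s = 0 -> forall i, snd (u i) = 0) ->
  (forall a, rsumv k a u = (0, 0) -> forall i, (i < k)%nat -> a i = 0) ->
  (forall v, rmv (Tr alpha ell s n) v = v -> (s = 0 -> snd v = 0) -> exists a, v = rsumv k a u) ->
  gmult n alpha ell (s ^ 2) k.
Proof.
  intros Hn Hs Ha Hell Hfix H0 Hind Hspan.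
  apply (gmult_basis n alpha ell (s ^ 2) k (fun i j => sol s (rmv (Tr alpha ell s j) (u i)))).
  - intros i Hi. apply vsol_eigfun, Tr_vsol; auto.
  - intros a Hz. apply Hind.
    assert (Hz0 : forall x, 0 <= x <= ell 0%nat -> sol s (rsumv k a u) x = 0).
    { intros x Hx. rewrite <- (Hz 0%nat ltac:(lia) x Hx), <- (rmv_id (rsumv k a u)) at 1.
      apply (sol_rsumv s rid). }
    specialize (Hell 0%nat ltac:(lia)). destruct (Req_dec s 0) as [->|Hne].
    + specialize (Hz0 0 ltac:(lra)). rewrite sol_zero_freq in Hz0. unfold rsumv in *; simpl in Hz0.
      f_equal; auto. apply rsum_zero; intros; rewrite H0; auto; ring.
    + apply (sol_nonzero s _ (ell 0%nat)); auto; lra.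
  - intros f Hf. destruct (eigfun_vsol n alpha ell s f Hell Hs Hf) as [w [Hw [Hfw Hw0]]].
    destruct (vsol_Tr n alpha ell s w Hn Ha Hw) as [Hj HM].
    destruct (Hspan (w 0%nat) HM) as [a E]; [auto|].
    exists a. intros j Hjn x Hx. rewrite (Hfw j Hjn x Hx), (Hj j Hjn), E. apply sol_rsumv.
Qed.

(** * No exceptional angles *)

Lemma winding_vmat v a K al : 0 < al -> ~ exceptional al -> winding v a K ->
  winding (fun s => rmv (vmat al) (v s)) a (K + PI / 2).
Proof.
  intros Ha Hn Hv. destruct (nonexceptional_theta al Ha Hn) as [Hs Hc].
  eapply winding_ext; [|apply (winding_dil v a K (cos (theta al) / sin (theta al)))]; auto.
  - intros s; simpl. f_equal; field; auto.
  - unfold Rdiv; apply Rmult_integral_contrapositive; split; auto. now apply Rinv_neq_0_compat.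
Qed.

Lemma trig_vec_ext v w : (forall s, v s = w s) -> trig_vec v -> trig_vec w.
Proof.
  intros E [H1 H2]; split; eapply is_trig_ext; [|exact H1| |exact H2]; intros; simpl; now rewrite E.
Qed.

Lemma trig_vec_vmat v al : trig_vec v -> trig_vec (fun s => rmv (vmat al) (v s)).
Proof.
  intros Hv. eapply trig_vec_ext;
    [|apply (trig_vec_dil (cos (theta al) / sin (theta al)) (sin (theta al) / cos (theta al)) _ Hv)].
  intros s; simpl; f_equal; ring.
Qed.

Lemma trig_vec_const v : trig_vec (fun _ => v).
Proof. split; apply is_trig_const. Qed.

Lemma trig_vec_Tr alpha ell k v : trig_vec (fun s => rmv (Tr alpha ell s k) v).
Proof.
  induction k.
  - eapply trig_vec_ext; [|apply (trig_vec_const v)]. intros; symmetry; apply rmv_id.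
  - eapply trig_vec_ext; [|exact (trig_vec_vmat _ (alpha k) (trig_vec_rot (ell k) _ IHk))].
    intros s; cbn [Tr]. now rewrite !rmv_rmm.
Qed.

(** Each edge adds its length to the rate and each vertex loses at most PI/2, so one edge already
    makes the rate positive. *)
Lemma winding_Tr alpha ell k v a K : winding (fun _ => v) a K -> 0 <= a ->
  (forall j, (j < k)%nat -> 0 < alpha j /\ ~ exceptional (alpha j)) ->
  (forall j, (j < k)%nat -> 0 < ell j) ->
  exists a' K', winding (fun s => rmv (Tr alpha ell s k) v) a' K' /\
    0 <= a' /\ ((1 <= k)%nat -> 0 < a').
Proof.
  intros Hv Ha. induction k; intros Hal Hell.
  - exists a, K. split; [|split; auto; lia]. eapply winding_ext; [|exact Hv].
    intros; symmetry; apply rmv_id.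
  - destruct IHk as [a' [K' [H1 [H2 _]]]]; auto.
    destruct (Hal k ltac:(lia)) as [Hp Hn]. specialize (Hell k ltac:(lia)).
    exists (ell k + a'), (K' + PI / 2). split; [|split; [|intros]; lra].
    eapply winding_ext; [|exact (winding_vmat _ _ _ (alpha k) Hp Hn (winding_rot _ _ _ (ell k) H1))].
    intros s; cbn [Tr]. now rewrite !rmv_rmm.
Qed.

Lemma is_trig_continuity f : is_trig f -> continuity f.
Proof.
  intros [l Hl] x. apply derivable_continuous_pt. exists (trig (trig_deriv l) x).
  eapply derivable_ext; [intros; symmetry; apply Hl|reflexivity|apply trig_derivable].
Qed.

Lemma is_trig_trace alpha ell k : is_trig (fun s => rtr (Tr alpha ell s k) + - 2).
Proof.
  apply is_trig_plus; [|apply is_trig_const].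
  eapply is_trig_ext; [|apply is_trig_plus;
    [exact (proj1 (trig_vec_Tr alpha ell k (1, 0)))|exact (proj2 (trig_vec_Tr alpha ell k (0, 1)))]].
  intros s; simpl. destruct (Tr alpha ell s k) as [[a b] [c d]]; simpl; ring.
Qed.

Lemma inv_sum_ge_2 r : 0 < r -> 2 <= r + / r.
Proof.
  intros Hr. pose proof (Rle_0_sqr (r - 1)) as H; unfold Rsqr in H.
  apply (Rmult_le_reg_r r); auto. rewrite Rmult_plus_distr_r, Rinv_l; lra.
Qed.

Lemma trace_of_eigenvector M r : rdet M = 1 -> rmv M (1, 0) = (r, 0) -> r <> 0 -> rtr M = r + / r.
Proof.
  destruct M as [[a b] [c d]]; simpl. intros Hd HM Hr. injection HM; intros E1 E2.
  assert (Ea : a = r) by lra; assert (Ec : c = 0) by lra. rewrite Ea, Ec in *.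
  f_equal. apply (Rmult_eq_reg_l r); auto. rewrite Rinv_r; lra.
Qed.

(* The image of (1,0) winds around the origin, so it meets both half-axes
   infinitely often: there the trace is r + 1/r >= 2, respectively <= -2. *)
Lemma trace_oscillates n alpha ell T : (1 <= n)%nat ->
  (forall j, (j < n)%nat -> 0 < alpha j /\ ~ exceptional (alpha j)) ->
  (forall j, (j < n)%nat -> 0 < ell j) ->
  (exists s, T < s /\ 2 <= rtr (Tr alpha ell s n)) /\
  (exists s, T < s /\ rtr (Tr alpha ell s n) <= - 2).
Proof.
  intros Hn Hal Hell.
  assert (H0 : winding (fun _ => (1, 0)) 0 (- 0)).
  { eapply winding_ext; [|apply (winding_const 1 ltac:(lra) 0)].
    intros; simpl. rewrite cos_0, sin_0; f_equal; ring. }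
  destruct (winding_Tr alpha ell n _ _ _ H0 ltac:(lra) Hal Hell) as [a [K [Hw [_ Hpos]]]].
  specialize (Hpos Hn). split.
  - destruct (winding_hits _ _ _ T 0 Hpos Hw) as [s [r [Hs [Hr E]]]].
    exists s; split; auto. rewrite cos_0, sin_0 in E.
    rewrite (trace_of_eigenvector _ r); [apply inv_sum_ge_2; auto|now apply rdet_Tr| |lra].
    rewrite E; f_equal; ring.
  - destruct (winding_hits _ _ _ T PI Hpos Hw) as [s [r [Hs [Hr E]]]].
    exists s; split; auto. rewrite cos_PI, sin_PI in E.
    rewrite (trace_of_eigenvector _ (- r)); [|now apply rdet_Tr| |lra].
    + pose proof (inv_sum_ge_2 r Hr). rewrite Rinv_opp; lra.
    + rewrite E; f_equal; ring.
Qed.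

Lemma Tr_zero_freq alpha ell k :
  (forall j, (j < k)%nat -> 0 < alpha j /\ ~ exceptional (alpha j)) ->
  exists p, p <> 0 /\ Tr alpha ell 0 k = ((p, 0), (0, / p)).
Proof.
  induction k; intros H.
  - exists 1; split; [lra|]. simpl. rewrite Rinv_1; auto.
  - destruct IHk as [p [Hp E]]; auto. destruct (H k ltac:(lia)) as [Ha Hn].
    destruct (nonexceptional_theta _ Ha Hn) as [Hs Hc].
    exists (cos (theta (alpha k)) / sin (theta (alpha k)) * p). split.
    + unfold Rdiv. repeat (apply Rmult_integral_contrapositive; split); auto.
      now apply Rinv_neq_0_compat.
    + cbn [Tr]. rewrite E, Rmult_0_r. unfold rot; rewrite cos_0, sin_0. simpl.
      pairs; field; auto.
Qed.

(** A matrix of determinant 1 fixes the plane if it is the identity, otherwise a line if its trace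
    is 2, otherwise only the origin. The last clause exposes positive quasi-eigenvalues as zeros of
    a trigonometric polynomial. *)
Lemma qmult_gmult_regular n alpha ell s : (1 <= n)%nat -> 0 <= s ->
  (forall j, (j < n)%nat -> 0 < alpha j /\ ~ exceptional (alpha j)) ->
  (forall j, (j < n)%nat -> 0 < ell j) ->
  exists k, qmult n alpha ell s k /\ gmult n alpha ell (s ^ 2) k /\
    (0 < s -> (k <> 0%nat <-> rtr (Tr alpha ell s n) = 2)).
Proof.
  intros Hn Hs Hal Hell.
  assert (Hex : forall j, (j < n)%nat -> ~ exceptional (alpha j)) by (intros; now apply Hal).
  assert (HD := rdet_Tr alpha ell s n Hal).
  assert (HT := Tprod_toC alpha ell s n Hal).
  destruct (Req_dec s 0) as [->|Hne].
  - destruct (Tr_zero_freq alpha ell n Hal) as [p [Hp E]].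
    destruct (Req_dec p 1) as [->|Hp1].
    (* The whole plane is fixed, but (0, 1) gives the zero function at frequency 0; hence
       multiplicity 1. *)
    + assert (Eid : Tr alpha ell 0 n = rid) by (rewrite E, Rinv_1; auto).
      exists 1%nat; split; [|split; [|intros; lra]].
      * right; left; split; auto. left; split; auto. left; split; auto.
        rewrite HT, Eid. apply has_eig1_toC. exists (1, 0); split; [|apply rmv_id].
        intros E1; injection E1; lra.
      * apply (gmult_waves n alpha ell 0 1 (fun _ => (1, 0))); auto.
        -- intros; rewrite Eid; apply rmv_id.
        -- intros a Ha i Hi. unfold rsumv in Ha; simpl in Ha. injection Ha; intros.
           replace i with 0%nat by lia. lra.
        -- intros [x y] _ H. specialize (H eq_refl); simpl in H. exists (fun _ => x).
           unfold rsumv; simpl. f_equal; lra.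
    + assert (Hfix : forall v, rmv (Tr alpha ell 0 n) v = v -> v = (0, 0)).
      { rewrite E. intros [x y]; simpl; intros H; injection H; intros H1 H2.
        assert (E1 : (p - 1) * x = 0) by lra. assert (E2 : (p - 1) * y = 0).
        { rewrite <- H1. replace ((p - 1) * (0 * x + / p * y)) with (y - / p * y) by (field; auto).
          lra. }
        apply Rmult_integral in E1, E2. f_equal; lra. }
      exists 0%nat; split; [|split; [|intros; lra]].
      * right; left; split; auto. left; split; auto. right; split; auto.
        rewrite HT, has_eig1_toC. intros [v [Hv Hv']]; auto.
      * apply (gmult_waves n alpha ell 0 0 (fun _ => (0, 0))); auto; try lia.
        intros v Hv _. exists (fun _ => 0). unfold rsumv; simpl; auto.
  - assert (Hq : forall k, fixed_dim (toC (Tr alpha ell s n)) k -> qmult n alpha ell s k).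
    { intros k Hk. right; left; split; auto. right; split; [lra|]. now rewrite HT. }
    destruct (classic (Tr alpha ell s n = rid)) as [E|Hnid];
      [|destruct (Req_dec (rtr (Tr alpha ell s n)) 2) as [Ht|Ht]].
    + exists 2%nat; split; [|split].
      * apply Hq. rewrite E; apply fixed_dim_2.
      * apply (gmult_waves n alpha ell s 2 (fun i => if (i =? 0)%nat then (1, 0) else (0, 1))); auto.
        -- intros; rewrite E; apply rmv_id.
        -- intros; lra.
        -- intros a Ha i Hi. unfold rsumv in Ha; simpl in Ha. injection Ha; intros.
           assert (Hi' : (i = 0 \/ i = 1)%nat) by lia. destruct Hi' as [-> | ->]; lra.
        -- intros [x y] _ _. exists (fun i => if (i =? 0)%nat then x else y).
           unfold rsumv; simpl. f_equal; lra.
      * intros _; split; [|auto]. intros _; rewrite E; simpl; lra.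
    + destruct (fixed_line _ HD Ht Hnid) as [b [Hb [Hfix Hspan]]].
      exists 1%nat; split; [|split].
      * apply Hq. now apply (fixed_dim_1 _ b).
      * apply (gmult_waves n alpha ell s 1 (fun _ => b)); auto.
        -- intros; lra.
        -- intros a Ha i Hi. replace i with 0%nat by lia.
           unfold rsumv in Ha; simpl in Ha. injection Ha; intros H1 H2.
           apply NNPP; intros Hn0. apply Hb. destruct b as [x y]; simpl in *.
           f_equal; apply (Rmult_eq_reg_l (a 0%nat)); auto; lra.
        -- intros v Hv _. destruct (Hspan v Hv) as [t ->]. exists (fun _ => t).
           unfold rsumv; simpl; f_equal; lra.
      * intros _; split; auto.
    + assert (Hfix : forall v, rmv (Tr alpha ell s n) v = v -> v = (0, 0)).
      { intros v Hv. apply NNPP; intros Hv0. apply Ht. now apply (fixed_trace _ v). }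
      exists 0%nat; split; [|split].
      * apply Hq. now apply fixed_dim_0.
      * apply (gmult_waves n alpha ell s 0 (fun _ => (0, 0))); auto; try lia.
        intros v Hv _. exists (fun _ => 0). unfold rsumv; simpl; auto.
      * intros _; split; [easy|]. intros; contradiction.
Qed.

Lemma trace_zeros_finite n alpha ell L : (1 <= n)%nat ->
  (forall j, (j < n)%nat -> 0 < alpha j /\ ~ exceptional (alpha j)) ->
  (forall j, (j < n)%nat -> 0 < ell j) ->
  exists l, forall s, 0 <= s <= L -> rtr (Tr alpha ell s n) = 2 -> In s l.
Proof.
  intros Hn Hal Hell.
  (* A point with trace at most -2 shows that trace - 2 is not identically zero. *)
  destruct (trace_oscillates n alpha ell 0 Hn Hal Hell) as [_ [s0 [_ Hs0]]].
  destruct (is_trig_finite_zeros _ 0 L (is_trig_trace alpha ell n)) as [l Hl].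
  - exists s0; lra.
  - exists l. intros s Hs E; apply Hl; auto; lra.
Qed.

Lemma trace_zeros_unbounded n alpha ell T : (1 <= n)%nat ->
  (forall j, (j < n)%nat -> 0 < alpha j /\ ~ exceptional (alpha j)) ->
  (forall j, (j < n)%nat -> 0 < ell j) ->
  exists s, T < s /\ rtr (Tr alpha ell s n) = 2.
Proof.
  intros Hn Hal Hell.
  destruct (trace_oscillates n alpha ell T Hn Hal Hell) as [[s0 [H0 Hs0]] _].
  destruct (trace_oscillates n alpha ell s0 Hn Hal Hell) as [_ [s1 [H1 Hs1]]].
  destruct (IVT_cor (fun s => rtr (Tr alpha ell s n) + - 2) s0 s1) as [z [Hz E]].
  - apply is_trig_continuity, is_trig_trace.
  - lra.
  - assert (0 <= (rtr (Tr alpha ell s0 n) + - 2) * - (rtr (Tr alpha ell s1 n) + - 2))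
      by (apply Rmult_le_pos; lra). lra.
  - exists z; split; lra.
Qed.

(** * Segments between exceptional vertices *)

Lemma mod_wrap n a : (a < 2 * n)%nat ->
  ((a < n)%nat /\ (a mod n = a)%nat) \/ ((n <= a)%nat /\ (a mod n = a - n)%nat).
Proof.
  intros H. destruct (Nat.lt_ge_cases a n) as [H1|H1]; [left; split; auto; now apply Nat.mod_small|].
  right; split; auto. replace a with ((a - n) + 1 * n)%nat at 1 by lia.
  rewrite Nat.Div0.mod_add. apply Nat.mod_small; lia.
Qed.

Lemma back_cases n e t : (e < n)%nat -> (t <= n)%nat ->
  ((t <= e)%nat /\ back n e t = (e - t)%nat) \/ ((e < t)%nat /\ back n e t = (e + n - t)%nat).
Proof.
  intros He Ht. unfold back. destruct (Nat.eq_dec t 0) as [->|Hne].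
  - left. rewrite Nat.sub_0_r. destruct (mod_wrap n (e + n)) as [[? ?]|[? ->]]; lia.
  - destruct (mod_wrap n (e + n - t)) as [[? ->]|[? ->]]; lia.
Qed.

Lemma succ_cases n j : (j < n)%nat ->
  ((S j < n)%nat /\ (S j mod n = S j)%nat) \/ (S j = n /\ (S j mod n = 0)%nat).
Proof. intros Hj. destruct (mod_wrap n (S j)) as [[? ->]|[? ->]]; lia. Qed.

Lemma back_lt n e t : (e < n)%nat -> (back n e t < n)%nat.
Proof. intros He. apply Nat.mod_upper_bound; lia. Qed.

Lemma back_0 n e : (e < n)%nat -> back n e 0 = e.
Proof. intros He. destruct (back_cases n e 0); lia. Qed.

Lemma back_n n e : (e < n)%nat -> back n e n = e.
Proof. intros He. destruct (back_cases n e n); lia. Qed.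

Lemma succ_back n e t : (e < n)%nat -> (t < n)%nat -> (S (back n e (S t)) mod n = back n e t)%nat.
Proof.
  intros He Ht. pose proof (back_lt n e (S t) He).
  destruct (succ_cases n (back n e (S t))); auto;
  destruct (back_cases n e (S t)), (back_cases n e t); lia.
Qed.

Lemma back_of_succ n j e t : (j < n)%nat -> (e < n)%nat -> (t < n)%nat ->
  (S j mod n)%nat = back n e t -> j = back n e (S t).
Proof.
  intros Hj He Ht H. destruct (succ_cases n j Hj), (back_cases n e (S t)), (back_cases n e t); lia.
Qed.

Lemma back_succ n j t : (j < n)%nat -> (t < n)%nat -> back n (S j mod n) (S t) = back n j t.
Proof.
  intros Hj Ht. pose proof (Nat.mod_upper_bound (S j) n ltac:(lia)).
  destruct (succ_cases n j Hj), (back_cases n (S j mod n) (S t)), (back_cases n j t); lia.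
Qed.

(** Reflection t -> e - t modulo n is an involution, so [back n e] also computes the number of steps
    from an edge to e. *)
Lemma back_dist n e t : (e < n)%nat -> (t < n)%nat -> back n e (back n e t) = t.
Proof.
  intros He Ht. pose proof (back_lt n e t He).
  destruct (back_cases n e t), (back_cases n e (back n e t)); lia.
Qed.

Lemma back_surj n e j : (e < n)%nat -> (j < n)%nat -> exists t, (t < n)%nat /\ j = back n e t.
Proof.
  intros He Hj. exists (back n e j). split; [now apply back_lt|]. symmetry; now apply back_dist.
Qed.

Lemma back_eq_back n e e' t t' : (e < n)%nat -> (e' < n)%nat -> (t <= t')%nat -> (t' <= n)%nat ->
  back n e t = back n e' t' -> e = back n e' (t' - t).
Proof.
  intros He He' Ht Ht' H.
  destruct (back_cases n e t), (back_cases n e' t'), (back_cases n e' (t' - t)); lia.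
Qed.

Lemma least_nat (P : nat -> Prop) : (exists k, P k) ->
  exists k, P k /\ forall i, (i < k)%nat -> ~ P i.
Proof.
  intros [k Hk]. induction k as [k IH] using lt_wf_ind.
  destruct (classic (exists i, (i < k)%nat /\ P i)) as [[i [Hi HP]]|Hn]; [eauto|].
  exists k; split; auto. intros i Hi HP; apply Hn; eauto.
Qed.

Lemma prev_exists n alpha e : (e < n)%nat -> (exists j, (j < n)%nat /\ exceptional (alpha j)) ->
  exists d, prev_exc_dist n alpha e d.
Proof.
  intros He [j [Hj Hx]].
  destruct (least_nat (fun d => (1 <= d <= n)%nat /\ exceptional (alpha (back n e d)))) as [d [[Hd Hd'] Hl]].
  - destruct (back_surj n e j He Hj) as [t [Ht ->]].
    destruct (Nat.eq_dec t 0) as [->|Hne].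
    + exists n; split; [lia|]. rewrite back_n by auto. now rewrite back_0 in Hx by auto.
    + exists t; split; [lia|auto].
  - exists d; split; [auto|split; auto]. intros d' Hd2 Hx2. apply (Hl d'); [lia|]. split; auto; lia.
Qed.

Lemma prev_unique n alpha e d d' : prev_exc_dist n alpha e d -> prev_exc_dist n alpha e d' -> d = d'.
Proof.
  intros [H1 [H2 H3]] [H1' [H2' H3']].
  destruct (Nat.lt_total d d') as [H|[H|H]]; auto; exfalso; [apply (H3' d)|apply (H3 d')]; auto; lia.
Qed.

(** * Parity of an exceptional vertex and the data it admits *)

Definition par (a : R) (b : bool) : Prop :=
  exists k : nat, (1 <= k)%nat /\ a = PI / (2 * INR k) /\ Nat.even k = b.

Lemma par_exceptional a : exceptional a <-> exists b, par a b.
Proof.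
  split; [intros [k [H1 H2]]; exists (Nat.even k), k; auto|intros [b [k [H1 [H2 _]]]]; exists k; auto].
Qed.

Lemma exceptional_inj k k' : (1 <= k)%nat -> (1 <= k')%nat ->
  PI / (2 * INR k) = PI / (2 * INR k') -> k = k'.
Proof.
  intros Hk Hk' H. pose proof PI_RGT_0.
  apply (le_INR 1) in Hk, Hk'. simpl in Hk, Hk'.
  apply INR_eq. apply (Rmult_eq_reg_l (PI / (2 * INR k))).
  - rewrite H at 2. field; lra.
  - apply Rmult_integral_contrapositive; split; [lra|]. apply Rinv_neq_0_compat; lra.
Qed.

Lemma par_unique a b b' : par a b -> par a b' -> b = b'.
Proof.
  intros [k [H1 [H2 <-]]] [k' [H1' [H2' <-]]]. f_equal.
  apply exceptional_inj; auto. congruence.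
Qed.

(* A vertex of parity b imposes coord b = 0 on the data arriving at it and
   coord (negb b) = 0 on the data leaving it, i.e. data along xdir b leave it. *)
Definition coord (b : bool) (v : R * R) : R := if b then fst v else snd v.
Definition xdir (b : bool) : R * R := if b then (1, 0) else (0, 1).
Definition scalv (c : R) (v : R * R) : R * R := (c * fst v, c * snd v).

Lemma coord_scalv b c v : coord b (scalv c v) = c * coord b v.
Proof. destruct b; auto. Qed.

Lemma rmv_scalv M c v : rmv M (scalv c v) = scalv c (rmv M v).
Proof. destruct M as [[p q] [r t]], v; unfold scalv; simpl; f_equal; ring. Qed.

Lemma coord_xdir b : coord b (xdir b) = 1.
Proof. destruct b; auto. Qed.

Lemma coord_zero_xdir b v : coord (negb b) v = 0 -> v = scalv (coord b v) (xdir b).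
Proof. destruct b, v as [x y]; unfold scalv; simpl; intros ->; f_equal; ring. Qed.

Lemma matching_exceptional a b x y : par a b ->
  (sin (theta a) * fst x = cos (theta a) * fst y /\
   cos (theta a) * snd x = sin (theta a) * snd y) <-> (coord b y = 0 /\ coord (negb b) x = 0).
Proof.
  intros [k [Hk [E <-]]]. pose proof (exceptional_theta a k Hk E) as H.
  assert (G : forall c u v, c <> 0 -> (0 * u = c * v <-> v = 0) /\ (c * u = 0 * v <-> u = 0)).
  { intros c u v Hc. repeat split; intros H1; try (subst; ring).
    - apply (Rmult_eq_reg_l c); lra.
    - apply (Rmult_eq_reg_l c); lra. }
  destruct (Nat.even k), H as [-> Hc]; simpl.
  - destruct (G _ (fst x) (fst y) Hc), (G _ (snd x) (snd y) Hc). tauto.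
  - destruct (G _ (fst x) (fst y) Hc), (G _ (snd x) (snd y) Hc). tauto.
Qed.

(** The phases built into [toV] make the even vector the image of (1, 0) and the odd one the image
    of (0, -1). The sign against [xdir] does not affect orthogonality. *)
Lemma Xof_par a X : Xof a X <-> exists b, par a b /\
  X = toV (if b then (1, 0) else (0, -1)) (0, 0).
Proof.
  assert (E2 : / sqrt 2 * / sqrt 2 = / 2).
  { rewrite <- Rinv_mult, sqrt_sqrt; lra. }
  assert (E : forall b, (if b : bool then Xeven else Xodd) = toV (if b then (1, 0) else (0, -1)) (0, 0)).
  { intros b. unfold Xeven, Xodd, Cexpi. rewrite cos_neg, sin_neg, cos_PI4, sin_PI4.
    replace (1 / sqrt 2) with (/ sqrt 2) by (unfold Rdiv; ring). revert E2.
    generalize (/ sqrt 2); intros r E2.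
    destruct b; unfold toV, Cmul, Cr; simpl; pairs; lra. }
  split.
  - intros [k [H1 [H2 ->]]]. exists (Nat.even k). split; [now exists k|apply E].
  - intros [b [[k [H1 [H2 <-]]] ->]]. exists k; repeat split; auto.
Qed.

Fixpoint Pr (n : nat) (alpha ell : nat -> R) (e : nat) (s : R) (t : nat) : RMat :=
  match t with
  | O => rid
  | S t' => rmm (Pr n alpha ell e s t')
                (rmm (vmat (alpha (back n e t))) (rot (ell (back n e t) * s)))
  end.

(** Carries data from the start of the edge t steps before e to the end of edge e, just before
    vertex e acts. *)
Definition Ur (n : nat) (alpha ell : nat -> R) (e : nat) (s : R) (t : nat) : RMat :=
  rmm (rot (ell e * s)) (Pr n alpha ell e s t).

Definition regular (a : R) : Prop := 0 < a /\ ~ exceptional a.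

Lemma Umat_toC n alpha ell e d s :
  (forall t, (1 <= t < d)%nat -> regular (alpha (back n e t))) ->
  Umat n alpha ell e d s = toC (Ur n alpha ell e s (d - 1)).
Proof.
  intros H. unfold Umat, Ur. rewrite toC_rot, <- toC_mul. f_equal.
  assert (G : forall t, (t <= d - 1)%nat -> Pprod n alpha ell e s t = toC (Pr n alpha ell e s t)).
  { induction t; intros Ht; cbn [Pprod Pr]; [apply toC_id|].
    destruct (H (S t) ltac:(lia)). rewrite IHt, toC_vmat, toC_rot, !toC_mul; auto; lia. }
  apply G; lia.
Qed.

Lemma rdet_Ur n alpha ell e s d t :
  (forall t, (1 <= t < d)%nat -> regular (alpha (back n e t))) -> (t < d)%nat ->
  rdet (Ur n alpha ell e s t) = 1.
Proof.
  intros H Ht. unfold Ur. rewrite rdet_rmm, rdet_rot.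
  assert (G : rdet (Pr n alpha ell e s t) = 1); [|rewrite G; ring].
  induction t; cbn [Pr]; [simpl; ring|].
  destruct (H (S t) ltac:(lia)). rewrite !rdet_rmm, rdet_vmat, rdet_rot, IHt; auto; [ring|lia].
Qed.

Lemma Ur_S n alpha ell e s t v :
  rmv (Ur n alpha ell e s (S t)) v =
  rmv (Ur n alpha ell e s t)
    (rmv (vmat (alpha (back n e (S t)))) (rmv (rot (ell (back n e (S t)) * s)) v)).
Proof. unfold Ur; cbn [Pr]. now rewrite !rmv_rmm. Qed.

Lemma Ur_0 n alpha ell e s v : rmv (Ur n alpha ell e s 0) v = rmv (rot (ell e * s)) v.
Proof. unfold Ur; cbn [Pr]. now rewrite rmv_rmm, rmv_id. Qed.

Lemma Ur_zero_freq n alpha ell e d t :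
  (forall t, (1 <= t < d)%nat -> regular (alpha (back n e t))) -> (t < d)%nat ->
  exists p, p <> 0 /\ Ur n alpha ell e 0 t = ((p, 0), (0, / p)).
Proof.
  intros H Ht. unfold Ur. rewrite Rmult_0_r. unfold rot at 1. rewrite cos_0, sin_0.
  assert (G : exists p, p <> 0 /\ Pr n alpha ell e 0 t = ((p, 0), (0, / p))).
  { induction t; cbn [Pr].
    - exists 1; split; [lra|]. rewrite Rinv_1; auto.
    - destruct IHt as [p [Hp E]]; [lia|]. destruct (H (S t) ltac:(lia)) as [Ha Hn].
      destruct (nonexceptional_theta _ Ha Hn) as [Hs Hc].
      rewrite E, Rmult_0_r. unfold rot; rewrite cos_0, sin_0.
      exists (p * (cos (theta (alpha (back n e (S t)))) / sin (theta (alpha (back n e (S t)))))). split.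
      + unfold Rdiv. repeat (apply Rmult_integral_contrapositive; split); auto.
        now apply Rinv_neq_0_compat.
      + simpl. pairs; field; auto. }
  destruct G as [p [Hp E]]. exists p; split; auto. rewrite E; simpl. pairs; ring.
Qed.

(* The solution leaving the previous exceptional vertex along its admissible
   direction satisfies the condition at the exceptional vertex e. *)
Definition resonant (n : nat) (alpha ell : nat -> R) (s : R) (e : nat) : Prop :=
  exists d b b', prev_exc_dist n alpha e d /\ par (alpha (back n e d)) b /\ par (alpha e) b' /\
    coord b' (rmv (Ur n alpha ell e s (d - 1)) (xdir b)) = 0.

Lemma prev_regular n alpha e d : (e < n)%nat -> (forall j, (j < n)%nat -> 0 < alpha j) ->
  prev_exc_dist n alpha e d -> forall t, (1 <= t < d)%nat -> regular (alpha (back n e t)).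
Proof.
  intros He Hal [_ [_ H]] t Ht. split; auto. apply Hal, back_lt; auto.
Qed.

Lemma exc_cond_resonant n alpha ell s e : (e < n)%nat -> (forall j, (j < n)%nat -> 0 < alpha j) ->
  exc_cond n alpha ell s e <-> resonant n alpha ell s e.
Proof.
  intros He Hal.
  assert (G : forall d b b', prev_exc_dist n alpha e d ->
    cdot (mvec (Umat n alpha ell e d s) (toV (if b : bool then (1, 0) else (0, -1)) (0, 0)))
         (toV (if b' : bool then (1, 0) else (0, -1)) (0, 0)) = C0 <->
    coord b' (rmv (Ur n alpha ell e s (d - 1)) (xdir b)) = 0).
  { intros d b b' Hd. rewrite (Umat_toC n alpha ell e d s) by (eapply prev_regular; eauto).
    rewrite toC_toV. destruct (Ur n alpha ell e s (d - 1)) as [[p q] [r t]].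
    (* The normalisation of [toV] is unitary, so orthogonality of amplitudes is orthogonality of
       real data. *)
    assert (E : forall u w, cdot (toV u (0, 0)) (toV w (0, 0)) = Cr (fst u * fst w + snd u * snd w)).
    { intros [u1 u2] [w1 w2]. unfold cdot, toV, Cadd, Cmul, Cconj, Cr; simpl. pairs; field. }
    replace (rmv ((p, q), (r, t)) (0, 0)) with (0, 0) by (simpl; f_equal; ring).
    rewrite E. unfold Cr, C0. split.
    - intros H; injection H; destruct b, b'; simpl; lra.
    - intros H; f_equal; destruct b, b'; simpl in *; lra. }
  split.
  - intros [Hx [d [X [X' [Hd [HX [HX' Hc]]]]]]].
    apply Xof_par in HX as [b [Hb ->]]. apply Xof_par in HX' as [b' [Hb' ->]].
    exists d, b, b'; repeat split; auto; apply Hd || (apply G; auto).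
  - intros [d [b [b' [Hd [Hb [Hb' Hc]]]]]]. split; [apply par_exceptional; eauto|].
    exists d; do 2 eexists; split; [auto|]. split; [apply Xof_par; eauto|].
    split; [apply Xof_par; eauto|]. apply G; auto.
Qed.

(** Edge j belongs to the segment ending at vertex e. These segments partition the edges. *)
Definition inseg (n : nat) (alpha : nat -> R) (j e : nat) : Prop :=
  exists d t, prev_exc_dist n alpha e d /\ (t < d)%nat /\ j = back n e t.

(** If j is t steps before e and t' >= t steps before e', then e is t' - t steps before e', in the
    interior of that segment unless t = t'; interior vertices are not exceptional. *)
Lemma inseg_unique n alpha j e e' : (e < n)%nat -> (e' < n)%nat ->
  exceptional (alpha e) -> exceptional (alpha e') ->
  inseg n alpha j e -> inseg n alpha j e' -> e = e'.
Proof.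
  assert (G : forall e e' d d' t t', (e < n)%nat -> (e' < n)%nat -> exceptional (alpha e) ->
    prev_exc_dist n alpha e d -> prev_exc_dist n alpha e' d' -> (t < d)%nat -> (t' < d')%nat ->
    (t <= t')%nat -> back n e t = back n e' t' -> e = e').
  { clear. intros e e' d d' t t' He He' Hx [Hd _] [Hd' [_ H]] Ht Ht' Hle E.
    apply back_eq_back in E; auto; [|lia].
    destruct (Nat.eq_dec t t') as [->|Hne].
    - rewrite Nat.sub_diag, back_0 in E; auto.
    - exfalso. apply (H (t' - t)%nat); [lia|]. now rewrite <- E. }
  intros He He' Hx Hx' [d [t [Hd [Ht E]]]] [d' [t' [Hd' [Ht' E']]]].
  destruct (Nat.le_ge_cases t t') as [H|H].
  - apply (G e e' d d' t t'); auto. congruence.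
  - symmetry; apply (G e' e d' d t' t); auto. congruence.
Qed.

Lemma inseg_exists n alpha j : (j < n)%nat -> (exists i, (i < n)%nat /\ exceptional (alpha i)) ->
  exists e, (e < n)%nat /\ exceptional (alpha e) /\ inseg n alpha j e.
Proof.
  intros Hj [i [Hi Hx]].
  destruct (least_nat (fun t => (t < n)%nat /\ exists e, (e < n)%nat /\ exceptional (alpha e) /\ j = back n e t))
    as [t [[Ht [e [He [Hxe Ej]]]] Hl]].
  - exists (back n i j). split; [now apply back_lt|]. exists i; repeat split; auto.
    symmetry; now apply back_dist.
  - exists e; repeat split; auto.
    destruct (prev_exists n alpha e He) as [d Hd]; [eauto|].
    exists d, t; repeat split; auto; [apply Hd..|].
    apply Nat.nle_gt; intros Hdt. destruct Hd as [Hd1 [Hd2 _]].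
    (* If d <= t, the exceptional vertex d steps before e would be reached from j in only t - d
       steps. *)
    apply (Hl (t - d)%nat); [lia|]. split; [lia|].
    exists (back n e d); split; [now apply back_lt|]. split; auto.
    pose proof (back_lt n e d He). pose proof (back_lt n e t He).
    destruct (back_cases n e t), (back_cases n e d), (back_cases n (back n e d) (t - d)); lia.
Qed.

(* Transport backwards from e of the data that satisfy the condition at e;
   back n e j is the number of steps from edge j to edge e. *)
Definition segwave (n : nat) (alpha ell : nat -> R) (s : R) (b' : bool) (e j : nat) : R * R :=
  if excluded_middle_informative (inseg n alpha j e)
  then rmv (radj (Ur n alpha ell e s (back n e j))) (xdir (negb b'))
  else (0, 0).

Lemma segwave_in n alpha ell s b' e d t : (e < n)%nat -> prev_exc_dist n alpha e d -> (t < d)%nat ->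
  segwave n alpha ell s b' e (back n e t) = rmv (radj (Ur n alpha ell e s t)) (xdir (negb b')).
Proof.
  intros He Hd Ht. unfold segwave. destruct (excluded_middle_informative _) as [H|H].
  - rewrite back_dist; auto. destruct Hd; lia.
  - exfalso; apply H. exists d, t; auto.
Qed.

Lemma segwave_out n alpha ell s b' e j : ~ inseg n alpha j e ->
  segwave n alpha ell s b' e j = (0, 0).
Proof. intros H. unfold segwave. now destruct (excluded_middle_informative _). Qed.

Lemma coord_xdir_negb b : coord b (xdir (negb b)) = 0.
Proof. destruct b; auto. Qed.

Lemma rmv_zero M : rmv M (0, 0) = (0, 0).
Proof. destruct M as [[p q] [r t]]; simpl; f_equal; ring. Qed.

(** The wave is anchored at e, so the condition there and those inside the segment hold by
    construction. Resonance is what gives the condition at the vertex where the segment starts. *)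
Lemma segwave_vsol n alpha ell s e d b b' : (e < n)%nat ->
  (forall j, (j < n)%nat -> 0 < alpha j) ->
  prev_exc_dist n alpha e d -> par (alpha (back n e d)) b -> par (alpha e) b' ->
  coord b' (rmv (Ur n alpha ell e s (d - 1)) (xdir b)) = 0 ->
  vsol n alpha ell s (segwave n alpha ell s b' e).
Proof.
  intros He Hal Hd Hb Hb' Hres j Hj.
  assert (Hreg := prev_regular n alpha e d He Hal Hd).
  assert (Hdn : (1 <= d <= n)%nat) by apply Hd.
  assert (HU : forall t, (t < d)%nat -> rdet (Ur n alpha ell e s t) = 1)
    by (intros; eapply rdet_Ur; eauto).
  assert (Hin : forall i, inseg n alpha i e -> exists t, (t < d)%nat /\ i = back n e t).
  { intros i [d' [t [Hd' [Ht E]]]]. rewrite (prev_unique _ _ _ _ _ Hd Hd'). eauto. }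
  destruct (classic (exceptional (alpha j))) as [Hx|Hx].
  - apply par_exceptional in Hx as [c Hc]. apply (matching_exceptional _ c); auto.
    assert (Hxj : exceptional (alpha j)) by (apply par_exceptional; eauto). split.
    + destruct (classic (inseg n alpha j e)) as [Hi|Hi].
      * destruct (Hin j Hi) as [t [Ht Ej]].
        destruct (Nat.eq_dec t 0) as [->|Hne].
        -- rewrite Ej at 2. rewrite (segwave_in n alpha ell s b' e d 0) by auto.
           rewrite back_0 in Ej by auto. subst j.
           rewrite <- (Ur_0 n alpha), rmv_radj by auto.
           rewrite (par_unique _ _ _ Hc Hb'). apply coord_xdir_negb.
        -- exfalso. destruct (Hreg t ltac:(lia)) as [_ Hr]. apply Hr. now rewrite <- Ej.
      * rewrite segwave_out, rmv_zero by auto. now destruct c.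
    + destruct (classic (inseg n alpha (S j mod n)%nat e)) as [Hi|Hi].
      * destruct (Hin _ Hi) as [t [Ht Ej]]. rewrite Ej.
        rewrite (segwave_in n alpha ell s b' e d t) by auto.
        apply back_of_succ in Ej; auto; [|lia].
        assert (Et : t = (d - 1)%nat).
        { destruct (Nat.eq_dec t (d - 1)) as [|Hne]; auto. exfalso.
          destruct (Hreg (S t) ltac:(lia)) as [_ Hr]. apply Hr. now rewrite <- Ej. }
        subst t. replace (S (d - 1)) with d in Ej by lia. rewrite Ej in Hc.
        rewrite (par_unique _ _ _ Hc Hb).
        set (U := Ur n alpha ell e s (d - 1)) in *.
        specialize (HU (d - 1)%nat ltac:(lia)). fold U in HU.
        (* By resonance U sends [xdir b] to a multiple of [xdir (negb b')]. The factor is nonzero,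
           since otherwise [xdir b] would vanish, so the wave starts along [xdir b]. *)
        assert (E : rmv U (xdir b) = scalv (coord (negb b') (rmv U (xdir b))) (xdir (negb b'))).
        { apply coord_zero_xdir. now rewrite Bool.negb_involutive. }
        assert (E2 : xdir b = scalv (coord (negb b') (rmv U (xdir b))) (rmv (radj U) (xdir (negb b')))).
        { rewrite <- rmv_scalv, <- E. symmetry; now apply rmv_radj_l. }
        assert (E3 := f_equal (coord (negb b)) E2). assert (E4 := f_equal (coord b) E2).
        rewrite coord_scalv in E3, E4. rewrite coord_xdir in E4.
        assert (E5 : coord (negb b) (xdir b) = 0) by (destruct b; auto).
        rewrite E5 in E3. symmetry in E3. apply Rmult_integral in E3 as [E3|E3]; auto.
        rewrite E3 in E4; lra.
      * rewrite segwave_out by auto. now destruct c.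
  - assert (Hpos : 0 < alpha j) by auto. apply matching_vmat; auto.
    destruct (classic (inseg n alpha j e)) as [Hi|Hi].
    + destruct (Hin j Hi) as [[|t] [Ht Ej]].
      { exfalso. rewrite back_0 in Ej by auto. subst; apply Hx, par_exceptional; eauto. }
      rewrite Ej, succ_back by (auto; lia).
      rewrite (segwave_in n alpha ell s b' e d t) by (auto; lia).
      rewrite (segwave_in n alpha ell s b' e d (S t)) by (auto; lia).
      rewrite <- (rmv_radj_l (Ur n alpha ell e s t)) by (apply HU; lia).
      rewrite <- Ur_S, rmv_radj by (apply HU; lia). auto.
    + rewrite !segwave_out, !rmv_zero; auto.
      intros Hi'. apply Hi. destruct (Hin _ Hi') as [t [Ht Ej]].
      apply back_of_succ in Ej; auto; [|lia].
      exists d, (S t); repeat split; auto; [apply Hd..|].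
      destruct (Nat.eq_dec (S t) d) as [E|E]; [|lia].
      exfalso; apply Hx. rewrite Ej, E. apply Hd.
Qed.

(** The condition at e leaves one free amplitude a, and all data in the segment are transported back
    from it. If a is nonzero, the starting datum is a nonzero multiple of [xdir b] whose image meets
    the condition at e, which is resonance. *)
Lemma vsol_segment n alpha ell s w e d b b' : (e < n)%nat ->
  (forall j, (j < n)%nat -> 0 < alpha j) ->
  prev_exc_dist n alpha e d -> par (alpha (back n e d)) b -> par (alpha e) b' ->
  vsol n alpha ell s w ->
  exists a, (forall t, (t < d)%nat ->
      w (back n e t) = scalv a (rmv (radj (Ur n alpha ell e s t)) (xdir (negb b')))) /\
    (a <> 0 -> coord b' (rmv (Ur n alpha ell e s (d - 1)) (xdir b)) = 0).
Proof.
  intros He Hal Hd Hb Hb' Hw.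
  assert (Hreg := prev_regular n alpha e d He Hal Hd).
  assert (Hdn : (1 <= d <= n)%nat) by apply Hd.
  set (y := rmv (rot (ell e * s)) (w e)).
  assert (Hy : coord b' y = 0).
  { eapply (matching_exceptional (alpha e)), (Hw e He); auto. }
  set (a := coord (negb b') y).
  assert (Ey : y = scalv a (xdir (negb b'))).
  { apply coord_zero_xdir. now rewrite Bool.negb_involutive. }
  assert (HUw : forall t, (t < d)%nat -> rmv (Ur n alpha ell e s t) (w (back n e t)) = y).
  { induction t; intros Ht; [rewrite back_0 by auto; apply Ur_0|].
    rewrite Ur_S, <- IHt by lia. f_equal. symmetry.
    rewrite <- succ_back by lia. pose proof (back_lt n e (S t) He) as Hb1.
    destruct (Hreg (S t) ltac:(lia)). apply matching_vmat; auto. }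
  exists a; split.
  - intros t Ht. rewrite <- rmv_scalv, <- Ey, <- (HUw t Ht).
    symmetry; apply rmv_radj_l. eapply rdet_Ur; eauto.
  - intros Ha. specialize (HUw (d - 1)%nat ltac:(lia)).
    assert (Hstart : coord (negb b) (w (back n e (d - 1))) = 0).
    { rewrite <- succ_back by lia. replace (S (d - 1)) with d by lia.
      eapply (matching_exceptional (alpha (back n e d))), Hw; auto. now apply back_lt. }
    rewrite (coord_zero_xdir b _ Hstart), rmv_scalv, Ey in HUw.
    assert (E1 := f_equal (coord b') HUw). assert (E2 := f_equal (coord (negb b')) HUw).
    rewrite !coord_scalv in E1, E2. rewrite coord_xdir_negb in E1. rewrite coord_xdir in E2.
    rewrite Rmult_0_r in E1. apply Rmult_integral in E1 as [E1|E1]; auto.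
    rewrite E1 in E2. lra.
Qed.

(** * Exceptional case and conclusion *)

Lemma count_all_unique P k k' : count_all P k -> count_all P k' -> k = k'.
Proof.
  intros [l [H1 [H2 <-]]] [l' [H1' [H2' <-]]].
  apply Nat.le_antisymm; apply NoDup_incl_length; auto; intros x Hx.
  - now apply H2', H2.
  - now apply H2, H2'.
Qed.

Lemma count_below_filter n (P : nat -> Prop) f : (forall j, (j < n)%nat -> (f j = true <-> P j)) ->
  count_below n P (length (filter f (seq 0 n))).
Proof.
  intros H. exists (filter f (seq 0 n)); repeat split.
  - apply NoDup_filter, seq_NoDup.
  - apply filter_In in H0 as [H0 _]. apply in_seq in H0; lia.
  - apply filter_In in H0 as [H0 H1]. apply in_seq in H0. apply H; auto; lia.
  - intros [H1 H2]. apply filter_In; split; [apply in_seq; lia|now apply H].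
Qed.

Lemma count_below_exists n P : exists k, count_below n P k.
Proof.
  eexists. apply (count_below_filter n P
    (fun j => if excluded_middle_informative (P j) then true else false)).
  intros j _. destruct (excluded_middle_informative (P j)); split; easy.
Qed.

Lemma count_below_nonzero n P k : count_below n P k ->
  (k <> 0%nat <-> exists e, (e < n)%nat /\ P e).
Proof.
  intros [l [_ [H <-]]]. split.
  - destruct l as [|e l]; [easy|]. intros _. exists e. apply H; now left.
  - intros [e He]. apply H in He. now destruct l.
Qed.

Lemma fixed_dim_unique T k k' : fixed_dim T k -> fixed_dim T k' -> k = k'.
Proof.
  intros [[fs [<- [H1 H2]]] H3] [[fs' [<- [H1' H2']]] H3'].
  apply Nat.le_antisymm; auto.
Qed.

Lemma qmult_unique n alpha ell s k k' :
  qmult n alpha ell s k -> qmult n alpha ell s k' -> k = k'.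
Proof.
  intros [[Hs ->]|[[Hn H]|[Hx H]]] [[Hs' ->]|[[Hn' H']|[Hx' H']]]; auto;
    try (destruct H as [[H ?]|[H ?]]; lra); try (destruct H' as [[H' ?]|[H' ?]]; lra);
    try (destruct Hx as [j [? ?]]; exfalso; eapply Hn'; eauto; fail);
    try (destruct Hx' as [j [? ?]]; exfalso; eapply Hn; eauto; fail).
  - destruct H as [[-> H]|[Hs H]], H' as [[E H']|[Hs' H']]; try lra.
    + destruct H as [[? ->]|[? ->]], H' as [[? ->]|[? ->]]; tauto.
    + eapply fixed_dim_unique; eauto.
  - destruct H as [[Hs H]|[-> H]], H' as [[Hs' H']|[E H']]; try lra.
    + eapply count_all_unique; eauto.
    + destruct H as [[? H]|[? ->]], H' as [[? H']|[? ->]]; try tauto.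
      pose proof (count_all_unique _ _ _ H H'); lia.
Qed.

Definition parb (a : R) : bool := if excluded_middle_informative (par a true) then true else false.

Lemma parb_spec a : exceptional a -> par a (parb a).
Proof.
  intros H. apply par_exceptional in H as [b Hb]. unfold parb.
  destruct (excluded_middle_informative _); auto. destruct b; tauto.
Qed.

Lemma sol_zero s x : sol s (0, 0) x = 0.
Proof. unfold sol. now rewrite rmv_zero. Qed.

Lemma sol_scalv s c v x : sol s (scalv c v) x = c * sol s v x.
Proof. unfold sol. now rewrite rmv_scalv. Qed.

(** [Good] marks the segments carrying a nonzero eigenfunction: all resonant ones for s > 0, but not
    all at s = 0, where a segment with two Dirichlet ends is resonant through the datum (0, 1) of
    the zero function. Disjoint supports give independence. *)
Lemma gmult_segments n alpha ell s Good k : 0 <= s ->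
  (forall j, (j < n)%nat -> 0 < alpha j) -> (forall j, (j < n)%nat -> 0 < ell j) ->
  (exists j, (j < n)%nat /\ exceptional (alpha j)) ->
  (forall e, (e < n)%nat -> Good e -> resonant n alpha ell s e) ->
  (forall e, (e < n)%nat -> Good e -> exists x, 0 <= x <= ell e /\
     sol s (segwave n alpha ell s (parb (alpha e)) e e) x <> 0) ->
  (forall e w, (e < n)%nat -> exceptional (alpha e) -> ~ Good e -> vsol n alpha ell s w ->
     (s = 0 -> forall j, snd (w j) = 0) -> forall j, inseg n alpha j e -> w j = (0, 0)) ->
  count_below n Good k -> gmult n alpha ell (s ^ 2) k.
Proof.
  intros Hs Hal Hell Hx Hres Hnz Hzero [l [Hnd [Hl <-]]].
  assert (Hexc : forall e, (e < n)%nat -> Good e -> exceptional (alpha e)).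
  { intros e He Hg. destruct (Hres e He Hg) as [d [b [b' [_ [_ [Hb' _]]]]]].
    apply par_exceptional; eauto. }
  set (ei i := nth i l 0%nat).
  assert (Hei : forall i, (i < length l)%nat -> (ei i < n)%nat /\ Good (ei i)).
  { intros i Hi. apply Hl. now apply nth_In. }
  assert (Hout : forall i e j, (i < length l)%nat -> (e < n)%nat -> exceptional (alpha e) ->
    inseg n alpha j e -> ei i <> e -> forall b' x, sol s (segwave n alpha ell s b' (ei i) j) x = 0).
  { intros i e j Hi He Hxe Hin Hne b' x. rewrite segwave_out; [apply sol_zero|].
    intros Hin'. apply Hne. destruct (Hei i Hi) as [Hi1 Hi2].
    apply (inseg_unique n alpha j); auto. }
  apply (gmult_basis n alpha ell (s ^ 2) (length l)
    (fun i j => sol s (segwave n alpha ell s (parb (alpha (ei i))) (ei i) j))).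
  - intros i Hi. destruct (Hei i Hi) as [He Hg].
    destruct (Hres _ He Hg) as [d [b [b' [Hd [Hb [Hb' Hr]]]]]].
    assert (Hp := parb_spec _ (Hexc _ He Hg)). rewrite (par_unique _ _ _ Hp Hb').
    apply vsol_eigfun. now apply (segwave_vsol n alpha ell s (ei i) d b b').
  - intros a Ha i Hi. destruct (Hei i Hi) as [He Hg].
    destruct (Hnz _ He Hg) as [x [Hxr Hx0]].
    specialize (Ha (ei i) He x Hxr). cbv beta in Ha.
    rewrite (rsum_single _ _ i) in Ha; auto.
    + apply Rmult_integral in Ha as [Ha|Ha]; tauto.
    + intros i' Hi' Hne. rewrite (Hout i' (ei i)); auto; [ring| |].
      * destruct (prev_exists n alpha (ei i) He Hx) as [d Hd].
        exists d, 0%nat; split; auto. split; [destruct Hd; lia|]. now rewrite back_0.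
      * intros E. apply Hne. eapply NoDup_nth; eauto.
  - intros f Hf. destruct (eigfun_vsol n alpha ell s f Hell Hs Hf) as [w [Hw [Hfw Hw0]]].
    assert (Hc : forall i, exists a, (i < length l)%nat -> forall j, inseg n alpha j (ei i) ->
      w j = scalv a (segwave n alpha ell s (parb (alpha (ei i))) (ei i) j)).
    { intros i. destruct (Nat.lt_ge_cases i (length l)) as [Hi|Hi]; [|exists 0; intros; lia].
      destruct (Hei i Hi) as [He Hg].
      destruct (Hres _ He Hg) as [d [b [b' [Hd [Hb [Hb' Hr]]]]]].
      assert (Hp := parb_spec _ (Hexc _ He Hg)). rewrite (par_unique _ _ _ Hp Hb').
      destruct (vsol_segment n alpha ell s w (ei i) d b b' He Hal Hd Hb Hb' Hw) as [a [Ha _]].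
      exists a. intros _ j [d' [t [Hd' [Ht ->]]]]. rewrite (prev_unique _ _ _ _ _ Hd' Hd) in Ht.
      rewrite (segwave_in n alpha ell s b' (ei i) d t); auto. }
    exists (fun i => proj1_sig (constructive_indefinite_description _ (Hc i))).
    assert (Ha := fun i => proj2_sig (constructive_indefinite_description _ (Hc i))).
    intros j Hj x Hxr. rewrite (Hfw j Hj x Hxr).
    destruct (inseg_exists n alpha j Hj Hx) as [e [He [Hxe Hin]]].
    destruct (classic (Good e)) as [Hg|Hg].
    + assert (Hel := proj2 (Hl e) (conj He Hg)).
      apply (In_nth _ _ 0%nat) in Hel as [i [Hi Ei]]. fold (ei i) in Ei. subst e.
      rewrite (rsum_single _ _ i); auto.
      * rewrite (Ha i Hi j Hin) at 1. apply sol_scalv.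
      * intros i' Hi' Hne. rewrite (Hout i' (ei i)); auto; [ring|].
        intros E. apply Hne. eapply NoDup_nth; eauto.
    + rewrite (Hzero e w He Hxe Hg Hw Hw0 j Hin), sol_zero. symmetry. apply rsum_zero.
      intros i Hi. rewrite (Hout i e); auto; [ring|].
      intros <-. apply Hg, Hei, Hi.
Qed.

Lemma segwave_self n alpha ell s b' e : (e < n)%nat ->
  (exists j, (j < n)%nat /\ exceptional (alpha j)) -> (forall j, (j < n)%nat -> 0 < alpha j) ->
  rmv (rot (ell e * s)) (segwave n alpha ell s b' e e) = xdir (negb b').
Proof.
  intros He Hx Hal. destruct (prev_exists n alpha e He Hx) as [d Hd].
  assert (Hd0 : (0 < d)%nat) by (destruct Hd; lia).
  pose proof (segwave_in n alpha ell s b' e d 0 He Hd Hd0) as E. rewrite back_0 in E by auto.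
  rewrite E, <- (Ur_0 n alpha), rmv_radj; auto.
  eapply rdet_Ur; eauto. eapply prev_regular; eauto.
Qed.

Lemma resonant_exceptional n alpha ell s e : resonant n alpha ell s e -> exceptional (alpha e).
Proof. intros [d [b [b' [_ [_ [Hb' _]]]]]]. apply par_exceptional; eauto. Qed.

Lemma vsol_nonresonant n alpha ell s w e : (e < n)%nat -> exceptional (alpha e) ->
  (forall j, (j < n)%nat -> 0 < alpha j) -> vsol n alpha ell s w ->
  exists a, (a <> 0 -> resonant n alpha ell s e) /\ forall j, inseg n alpha j e ->
    w j = scalv a (segwave n alpha ell s (parb (alpha e)) e j).
Proof.
  intros He Hx Hal Hw.
  destruct (prev_exists n alpha e He) as [d Hd]; [eauto|].
  assert (Hb : exists b, par (alpha (back n e d)) b) by (apply par_exceptional, Hd).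
  destruct Hb as [b Hb]. assert (Hb' := parb_spec _ Hx).
  destruct (vsol_segment n alpha ell s w e d b _ He Hal Hd Hb Hb' Hw) as [a [Ha Har]].
  exists a; split.
  - intros H. exists d, b, (parb (alpha e)); auto.
  - intros j [d' [t [Hd' [Ht ->]]]]. rewrite (prev_unique _ _ _ _ _ Hd' Hd) in Ht.
    rewrite (segwave_in n alpha ell s _ e d t); auto.
Qed.

Lemma gmult_exceptional_pos n alpha ell s k : 0 < s ->
  (forall j, (j < n)%nat -> 0 < alpha j) -> (forall j, (j < n)%nat -> 0 < ell j) ->
  (exists j, (j < n)%nat /\ exceptional (alpha j)) ->
  count_below n (resonant n alpha ell s) k -> gmult n alpha ell (s ^ 2) k.
Proof.
  intros Hs Hal Hell Hx. apply gmult_segments; auto; [lra| |].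
  - intros e He Hr. apply NNPP; intros Hn.
    set (v := segwave n alpha ell s (parb (alpha e)) e e) in *.
    assert (E : v = (0, 0)).
    { apply (sol_nonzero s v (ell e)); auto. intros x Hxr. apply NNPP; intros H; eauto. }
    pose proof (segwave_self n alpha ell s (parb (alpha e)) e He Hx Hal) as Es.
    fold v in Es. rewrite E, rmv_zero in Es.
    destruct (parb (alpha e)); simpl in Es; injection Es; lra.
  - intros e w He Hxe Hr Hw _ j Hj.
    destruct (vsol_nonresonant n alpha ell s w e He Hxe Hal Hw) as [a [Ha E]].
    rewrite E by auto. destruct (Req_dec a 0) as [->|Hne]; [|tauto].
    unfold scalv; f_equal; ring.
Qed.

(* At frequency 0 the only solutions are constants, which survive exactly on
   the segments that start with a Neumann and end with a Neumann condition. *)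
Definition neumann_segment (n : nat) (alpha : nat -> R) (e : nat) : Prop :=
  exists d, prev_exc_dist n alpha e d /\ par (alpha (back n e d)) true /\ par (alpha e) false.

Lemma resonant_zero_freq n alpha ell e d (b b' : bool) : (e < n)%nat ->
  (forall j, (j < n)%nat -> 0 < alpha j) -> prev_exc_dist n alpha e d ->
  (coord b' (rmv (Ur n alpha ell e 0 (d - 1)) (xdir b)) = 0 <-> b <> b').
Proof.
  intros He Hal Hd.
  destruct (Ur_zero_freq n alpha ell e d (d - 1)) as [p [Hp ->]].
  - eapply prev_regular; eauto.
  - destruct Hd; lia.
  - assert (/ p <> 0) by now apply Rinv_neq_0_compat.
    destruct b, b'; simpl; split; intros; try easy; lra.
Qed.

Lemma gmult_exceptional_zero n alpha ell k :
  (forall j, (j < n)%nat -> 0 < alpha j) -> (forall j, (j < n)%nat -> 0 < ell j) ->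
  (exists j, (j < n)%nat /\ exceptional (alpha j)) ->
  count_below n (neumann_segment n alpha) k -> gmult n alpha ell (0 ^ 2) k.
Proof.
  intros Hal Hell Hx. apply gmult_segments; auto; [lra| | |].
  - intros e He [d [Hd [Hb Hb']]]. exists d, true, false; repeat split; auto; try apply Hd.
    now apply resonant_zero_freq.
  - intros e He [d [Hd [Hb Hb']]]. exists 0; split; [specialize (Hell e He); lra|].
    pose proof (segwave_self n alpha ell 0 (parb (alpha e)) e He Hx Hal) as Es.
    rewrite (par_unique _ _ _ (parb_spec _ (proj2 (par_exceptional _) (ex_intro _ _ Hb'))) Hb') in *.
    rewrite sol_zero_freq. rewrite Rmult_0_r in Es. unfold rot in Es.
    rewrite cos_0, sin_0 in Es. destruct (segwave _ _ _ _ _ _ _); simpl in *.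
    injection Es; lra.
  - intros e w He Hxe Hr Hw Hw0 j Hj.
    destruct (vsol_nonresonant n alpha ell 0 w e He Hxe Hal Hw) as [a [Ha E]].
    rewrite E by auto. destruct (Req_dec a 0) as [->|Hne]; [unfold scalv; f_equal; ring|].
    exfalso. destruct (Ha Hne) as [d [b [b' [Hd [Hb [Hb' Hres]]]]]].
    apply resonant_zero_freq in Hres; auto.
    assert (Hself : inseg n alpha e e).
    { exists d, 0%nat; split; auto. split; [destruct Hd; lia|]. now rewrite back_0. }
    pose proof (segwave_self n alpha ell 0 (parb (alpha e)) e He Hx Hal) as Es.
    specialize (E e Hself). specialize (Hw0 eq_refl e). rewrite E in Hw0.
    rewrite (par_unique _ _ _ (parb_spec _ Hxe) Hb') in *.
    rewrite Rmult_0_r in Es. unfold rot in Es. rewrite cos_0, sin_0 in Es.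
    destruct (segwave n alpha ell 0 b' e e) as [x y]; simpl in *.
    (* With a Dirichlet end the wave has datum (0, 1), excluded by the vanishing second coordinate;
       with a Neumann end, resonance makes the start Neumann too. *)
    destruct b'; simpl in Es.
    + injection Es; intros. apply Rmult_integral in Hw0; lra.
    + apply Hr. destruct b; [|easy]. exists d; auto.
Qed.

(** * Pairing of parity changes around the cycle *)

Definition cnt (f : nat -> bool) (m : nat) : nat := length (filter f (seq 0 m)).

Lemma cnt_S f m : cnt f (S m) = (cnt f m + Nat.b2n (f m))%nat.
Proof.
  unfold cnt. rewrite seq_S, filter_app, length_app; simpl. now destruct (f m).
Qed.

(** Downward minus upward changes telescope to q 0 - q m; the identity is written with additions
    only, to avoid truncated subtraction. *)
Lemma sign_changes (q : nat -> bool) m :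
  let down := fun j => (q j && negb (q (S j)))%bool in
  (cnt down m + Nat.b2n (q m) + (cnt down m + Nat.b2n (q m))
   = cnt (fun j => xorb (q j) (q (S j))) m + Nat.b2n (q 0%nat) + Nat.b2n (q m))%nat.
Proof.
  intros down. induction m; [unfold cnt; simpl; lia|].
  rewrite !cnt_S. unfold down in *. destruct (q m), (q (S m)), (q 0%nat); simpl in *; lia.
Qed.

(** Parity of the last exceptional vertex strictly before j. Being defined at every vertex, it is a
    sequence on the whole cycle that can change only on passing an exceptional vertex. *)
Definition prevpar (n : nat) (alpha : nat -> R) (j : nat) : bool :=
  if excluded_middle_informative
    (exists d, prev_exc_dist n alpha j d /\ par (alpha (back n j d)) true) then true else false.

Lemma prevpar_spec n alpha j d : prev_exc_dist n alpha j d ->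
  par (alpha (back n j d)) (prevpar n alpha j).
Proof.
  intros Hd. unfold prevpar. destruct (excluded_middle_informative _) as [[d' [Hd' H]]|H].
  - now rewrite (prev_unique _ _ _ _ _ Hd Hd').
  - assert (Hx : exceptional (alpha (back n j d))) by apply Hd.
    apply par_exceptional in Hx as [b Hb]. destruct b; auto. exfalso; eauto.
Qed.

Lemma prevpar_succ_exceptional n alpha j c : (j < n)%nat -> par (alpha j) c ->
  prevpar n alpha (S j mod n) = c.
Proof.
  intros Hj Hc. assert (Hb : back n (S j mod n) 1 = j).
  { rewrite back_succ by lia. now apply back_0. }
  assert (Hd : prev_exc_dist n alpha (S j mod n) 1).
  { split; [lia|]. rewrite Hb. split; [apply par_exceptional; eauto|intros; lia]. }
  pose proof (prevpar_spec _ _ _ _ Hd) as Hp. rewrite Hb in Hp. eapply par_unique; eauto.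
Qed.

Lemma prevpar_succ_regular n alpha j : (j < n)%nat -> ~ exceptional (alpha j) ->
  (exists i, (i < n)%nat /\ exceptional (alpha i)) ->
  prevpar n alpha (S j mod n) = prevpar n alpha j.
Proof.
  intros Hj Hn Hx. destruct (prev_exists n alpha j Hj Hx) as [d Hd].
  assert (Hdn : (1 <= d < n)%nat).
  { destruct Hd as [H1 [H2 _]]. destruct (Nat.eq_dec d n) as [->|]; [|lia].
    rewrite back_n in H2 by auto; tauto. }
  assert (Hd' : prev_exc_dist n alpha (S j mod n) (S d)).
  { destruct Hd as [H1 [H2 H3]]. split; [lia|]. rewrite back_succ by lia. split; auto.
    intros [|t] Ht; [lia|]. rewrite back_succ by lia.
    destruct (Nat.eq_dec t 0) as [->|]; [rewrite back_0; auto|apply H3; lia]. }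
  pose proof (prevpar_spec _ _ _ _ Hd) as Hp. pose proof (prevpar_spec _ _ _ _ Hd') as Hp'.
  rewrite back_succ in Hp' by lia. eapply par_unique; eauto.
Qed.

(* The parity of the last exceptional vertex changes equally often in both
   directions around the cycle, so parity changes are twice the Neumann segments. *)
Lemma parity_change_count n alpha : (exists i, (i < n)%nat /\ exceptional (alpha i)) ->
  exists k, count_below n (neumann_segment n alpha) k /\ count_below n (parity_change n alpha) (2 * k).
Proof.
  intros Hx. assert (Hn : (0 < n)%nat) by (destruct Hx; lia).
  set (q j := prevpar n alpha (j mod n)).
  assert (Hq : forall j, (j < n)%nat -> q j = prevpar n alpha j)
    by (intros; unfold q; now rewrite Nat.mod_small).
  exists (cnt (fun j => (q j && negb (q (S j)))%bool) n). split.
  - apply count_below_filter. intros e He. rewrite Hq by auto. unfold q.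
    destruct (prev_exists n alpha e He Hx) as [d Hd]. pose proof (prevpar_spec _ _ _ _ Hd) as Hp.
    split.
    + intros H. apply andb_prop in H as [H1 H2]. apply Bool.negb_true_iff in H2.
      destruct (classic (exceptional (alpha e))) as [Hxe|Hxe].
      * apply par_exceptional in Hxe as [c Hc]. rewrite (prevpar_succ_exceptional _ _ _ c) in H2; auto.
        subst c. rewrite H1 in Hp. exists d; auto.
      * rewrite prevpar_succ_regular in H2; auto. congruence.
    + intros [d' [Hd' [H1 H2]]]. rewrite (prevpar_succ_exceptional _ _ _ false); auto.
      pose proof (prevpar_spec _ _ _ _ Hd') as Hp'. rewrite (par_unique _ _ _ Hp' H1). auto.
  - pose proof (sign_changes q n) as Hs; cbv zeta in Hs.
    (* Closing the cycle cancels the boundary terms of the telescoping identity. *)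
    assert (E : q n = q 0%nat) by (unfold q; rewrite Nat.Div0.mod_same, Nat.mod_small; auto).
    rewrite E in Hs.
    match goal with |- count_below _ _ ?K =>
      replace K with (cnt (fun j => xorb (q j) (q (S j))) n) by lia end.
    apply count_below_filter. intros e He. rewrite Hq by auto. unfold q.
    destruct (prev_exists n alpha e He Hx) as [d Hd]. pose proof (prevpar_spec _ _ _ _ Hd) as Hp.
    split.
    + intros H. destruct (classic (exceptional (alpha e))) as [Hxe|Hxe].
      * split; auto. exists d; split; auto.
        apply par_exceptional in Hxe as [c Hc]. rewrite (prevpar_succ_exceptional _ _ _ c) in H; auto.
        destruct Hp as [k [Hk1 [Hk2 Hk3]]], Hc as [k' [Hk1' [Hk2' Hk3']]].
        exists k, k'; repeat split; auto. rewrite Hk3, Hk3'. intros E2; rewrite E2, Bool.xorb_nilpotent in H; easy.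
      * rewrite prevpar_succ_regular, Bool.xorb_nilpotent in H; auto; easy.
    + intros [Hxe [d' [Hd' [k [k' [Hk1 [Hk1' [Hk2 [Hk2' Hne]]]]]]]]].
      rewrite (prevpar_succ_exceptional _ _ _ (Nat.even k')) by (auto; exists k'; auto).
      rewrite (prev_unique _ _ _ _ _ Hd Hd') in Hp.
      rewrite (par_unique _ _ (Nat.even k) Hp) by (exists k; auto).
      destruct (Nat.even k), (Nat.even k'); simpl; tauto.
Qed.

Lemma count_below_ext n P Q k : (forall j, (j < n)%nat -> (P j <-> Q j)) ->
  count_below n P k -> count_below n Q k.
Proof.
  intros H [l [H1 [H2 H3]]]. exists l; split; auto. split; auto.
  intros m. rewrite H2. split; intros [Hm HP]; split; auto; now apply H.
Qed.

Lemma qmult_gmult_exceptional n alpha ell s : 0 <= s ->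
  (forall j, (j < n)%nat -> 0 < alpha j) -> (forall j, (j < n)%nat -> 0 < ell j) ->
  (exists j, (j < n)%nat /\ exceptional (alpha j)) ->
  exists k, qmult n alpha ell s k /\ gmult n alpha ell (s ^ 2) k /\
    (0 < s -> (k <> 0%nat <-> exists e, (e < n)%nat /\ resonant n alpha ell s e)).
Proof.
  intros Hs Hal Hell Hx. destruct (Req_dec s 0) as [->|Hne].
  - destruct (parity_change_count n alpha Hx) as [k [Hk1 Hk2]].
    exists k; split; [|split; [now apply gmult_exceptional_zero|intros; lra]].
    right; right; split; auto. right; split; auto.
    (* If 0 is not a quasi-eigenvalue the count must be 0, and indeed a Neumann segment would be
       resonant at 0. *)
    destruct (classic (exists e, (e < n)%nat /\ exc_cond n alpha ell 0 e)) as [He|He]; [now left|].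
    right; split; auto. apply NNPP; intros Hk0. apply He.
    apply (count_below_nonzero _ _ _ Hk1) in Hk0 as [e [Hen [d [Hd [Hb Hb']]]]].
    exists e; split; auto. apply exc_cond_resonant; auto.
    exists d, true, false; repeat split; auto; try apply Hd. now apply resonant_zero_freq.
  - destruct (count_below_exists n (resonant n alpha ell s)) as [k Hk].
    exists k; split; [|split].
    + right; right; split; auto. left; split; [lra|].
      eapply count_below_ext; [|exact Hk]. intros; symmetry; now apply exc_cond_resonant.
    + apply gmult_exceptional_pos; auto; lra.
    + intros _. now apply count_below_nonzero.
Qed.

(** * Oscillation along a segment *)

Lemma winding_Ur n alpha ell e t v a K : 0 < ell e -> 0 <= a -> winding v a K ->
  (forall i, (1 <= i <= t)%nat -> regular (alpha (back n e i)) /\ 0 < ell (back n e i)) ->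
  exists a' K', 0 < a' /\ winding (fun s => rmv (Ur n alpha ell e s t) (v s)) a' K'.
Proof.
  intros He Ha Hv H.
  assert (G : exists a' K', 0 <= a' /\ winding (fun s => rmv (Pr n alpha ell e s t) (v s)) a' K').
  { revert v a K Ha Hv; induction t; intros v a K Ha Hv.
    - exists a, K; split; auto. eapply winding_ext; [|exact Hv]. intros; symmetry; apply rmv_id.
    - destruct (H (S t) ltac:(lia)) as [[Hp Hn] Hl].
      destruct (IHt ltac:(intros; apply H; lia) _ (ell (back n e (S t)) + a) (K + PI / 2) ltac:(lra)
        (winding_vmat _ _ _ _ Hp Hn (winding_rot _ _ _ (ell (back n e (S t))) Hv)))
        as [a' [K' [Ha' Hw]]].
      exists a', K'; split; auto. eapply winding_ext; [|exact Hw].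
      intros s; cbn [Pr]. now rewrite !rmv_rmm. }
  destruct G as [a' [K' [Ha' Hw]]].
  exists (ell e + a'), K'; split; [lra|].
  eapply winding_ext; [|exact (winding_rot _ _ _ (ell e) Hw)].
  intros s; unfold Ur. now rewrite !rmv_rmm.
Qed.

Lemma trig_vec_Ur n alpha ell e t v : trig_vec v ->
  trig_vec (fun s => rmv (Ur n alpha ell e s t) (v s)).
Proof.
  intros Hv.
  assert (G : trig_vec (fun s => rmv (Pr n alpha ell e s t) (v s))).
  { revert v Hv; induction t; intros v Hv.
    - eapply trig_vec_ext; [|exact Hv]. intros; symmetry; apply rmv_id.
    - eapply trig_vec_ext; [|exact (IHt _ (trig_vec_vmat _ (alpha (back n e (S t)))
        (trig_vec_rot (ell (back n e (S t))) _ Hv)))].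
      intros s; cbn [Pr]. now rewrite !rmv_rmm. }
  eapply trig_vec_ext; [|exact (trig_vec_rot (ell e) _ G)].
  intros s; unfold Ur. now rewrite !rmv_rmm.
Qed.

Lemma segment_oscillates n alpha ell e d (b b' : bool) T : (e < n)%nat ->
  (forall j, (j < n)%nat -> 0 < alpha j) -> (forall j, (j < n)%nat -> 0 < ell j) ->
  prev_exc_dist n alpha e d ->
  (exists s, T < s /\ coord b' (rmv (Ur n alpha ell e s (d - 1)) (xdir b)) = 0) /\
  (exists s, T < s /\ coord b' (rmv (Ur n alpha ell e s (d - 1)) (xdir b)) <> 0).
Proof.
  intros He Hal Hell Hd.
  (* Clockwise angle of [xdir b]: the vector (0, 1) lies at -PI/2. *)
  set (t0 := if b then 0 else - (PI / 2)).
  assert (Hw0 : winding (fun _ => xdir b) 0 (- t0)).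
  { eapply winding_ext; [|apply (winding_const 1 ltac:(lra) t0)]. intros s; unfold t0.
    destruct b; simpl; rewrite ?cos_neg, ?sin_neg, ?cos_0, ?sin_0, ?cos_PI2, ?sin_PI2; f_equal; ring. }
  destruct (winding_Ur n alpha ell e (d - 1) _ 0 _ (Hell e He) (Rle_refl 0) Hw0) as [a [K [Ha Hw]]].
  { intros i Hi. split; [apply (prev_regular n alpha e d He Hal Hd); lia|apply Hell, back_lt; auto]. }
  split.
  - destruct (winding_hits _ _ _ T (if b' then PI / 2 else 0) Ha Hw) as [s [r [Hs [Hr E]]]].
    exists s; split; auto. rewrite E.
    destruct b'; simpl; rewrite ?cos_PI2, ?sin_0; ring.
  - destruct (winding_hits _ _ _ T (if b' then 0 else PI / 2) Ha Hw) as [s [r [Hs [Hr E]]]].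
    exists s; split; auto. rewrite E.
    destruct b'; simpl; rewrite ?cos_0, ?sin_PI2; lra.
Qed.

Lemma resonances_finite n alpha ell L :
  (forall j, (j < n)%nat -> 0 < alpha j) -> (forall j, (j < n)%nat -> 0 < ell j) ->
  exists l, forall s, 0 <= s <= L -> (exists e, (e < n)%nat /\ resonant n alpha ell s e) -> In s l.
Proof.
  intros Hal Hell.
  assert (G : forall m, (m <= n)%nat -> exists l, forall s, 0 <= s <= L ->
    (exists e, (e < m)%nat /\ resonant n alpha ell s e) -> In s l).
  { induction m; intros Hm; [exists []; intros s _ [e [He _]]; lia|].
    destruct IHm as [l Hl]; [lia|].
    assert (Hm' : exists l', forall s, 0 <= s <= L -> resonant n alpha ell s m -> In s l').
    { destruct (classic (exceptional (alpha m))) as [Hx|Hx];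
        [|exists []; intros s _ Hr; exfalso; apply Hx; eapply resonant_exceptional; eauto].
      destruct (prev_exists n alpha m ltac:(lia)) as [d Hd]; [exists m; auto|].
      assert (Hb : exists b, par (alpha (back n m d)) b) by (apply par_exceptional, Hd).
      destruct Hb as [b Hb]. apply par_exceptional in Hx as [b' Hb'].
      destruct (segment_oscillates n alpha ell m d b b' 0 ltac:(lia) Hal Hell Hd) as [_ [s0 [_ Hs0]]].
      destruct (is_trig_finite_zeros (fun s => coord b' (rmv (Ur n alpha ell m s (d - 1)) (xdir b))) 0 L)
        as [l' Hl'].
      - destruct (trig_vec_Ur n alpha ell m (d - 1) _ (trig_vec_const (xdir b))). destruct b'; auto.
      - eauto.
      - exists l'. intros s Hs [d1 [b1 [b1' [Hd1 [Hb1 [Hb1' Hr]]]]]]. apply Hl'; auto.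
        rewrite (prev_unique _ _ _ _ _ Hd Hd1) in *.
        now rewrite (par_unique _ _ _ Hb Hb1), (par_unique _ _ _ Hb' Hb1'). }
    destruct Hm' as [l' Hl']. exists (l ++ l'). intros s Hs [e [He Hr]]. apply in_or_app.
    destruct (Nat.eq_dec e m) as [->|Hne]; [right; auto|left; apply Hl; auto].
    exists e; split; auto; lia. }
  apply (G n); auto.
Qed.

Lemma resonances_unbounded n alpha ell T :
  (forall j, (j < n)%nat -> 0 < alpha j) -> (forall j, (j < n)%nat -> 0 < ell j) ->
  (exists j, (j < n)%nat /\ exceptional (alpha j)) ->
  exists s, T < s /\ exists e, (e < n)%nat /\ resonant n alpha ell s e.
Proof.
  intros Hal Hell [e [He Hx]].
  destruct (prev_exists n alpha e He) as [d Hd]; [eauto|].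
  assert (Hb : exists b, par (alpha (back n e d)) b) by (apply par_exceptional, Hd).
  destruct Hb as [b Hb]. apply par_exceptional in Hx as [b' Hb'].
  destruct (segment_oscillates n alpha ell e d b b' T He Hal Hell Hd) as [[s [Hs E]] _].
  exists s; split; auto. exists e; split; auto. exists d, b, b'; auto.
Qed.

(** The two cases merge here: Z stands for the positive quasi-eigenvalues, of which only local
    finiteness and unboundedness matter afterwards. *)
Lemma qmult_summary n alpha ell : (1 <= n)%nat ->
  (forall j, (j < n)%nat -> 0 < alpha j) -> (forall j, (j < n)%nat -> 0 < ell j) ->
  exists Z : R -> Prop,
    (forall s, 0 <= s -> exists k, qmult n alpha ell s k /\ gmult n alpha ell (s ^ 2) k /\
       (0 < s -> (k <> 0%nat <-> Z s))) /\
    (forall L, exists l, forall s, 0 <= s <= L -> Z s -> In s l) /\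
    (forall T, exists s, T < s /\ Z s).
Proof.
  intros Hn Hal Hell.
  destruct (classic (exists j, (j < n)%nat /\ exceptional (alpha j))) as [Hx|Hx].
  - exists (fun s => exists e, (e < n)%nat /\ resonant n alpha ell s e); split; [|split].
    + intros; now apply qmult_gmult_exceptional.
    + intros; now apply resonances_finite.
    + intros; now apply resonances_unbounded.
  - assert (Hreg : forall j, (j < n)%nat -> 0 < alpha j /\ ~ exceptional (alpha j)).
    { intros j Hj; split; auto. intros H; eauto. }
    exists (fun s => rtr (Tr alpha ell s n) = 2); split; [|split].
    + intros; now apply qmult_gmult_regular.
    + intros; now apply trace_zeros_finite.
    + intros; now apply trace_zeros_unbounded.
Qed.

Lemma count_all_ext P Q k : (forall m, P m <-> Q m) -> count_all P k -> count_all Q k.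
Proof.
  intros H [l [H1 [H2 H3]]]. exists l; split; auto. split; auto. intros m. now rewrite H2.
Qed.

Lemma count_all_zero P : count_all P 0 -> forall m, ~ P m.
Proof. intros [[|] [_ [H E]]] m HP; [now apply H in HP|easy]. Qed.

Theorem theorem2p18 (n : nat) (alpha ell : nat -> R)
  (Hn : (1 <= n)%nat)
  (Halpha : forall j, (j < n)%nat -> 0 < alpha j < PI)
  (Hell : forall j, (j < n)%nat -> 0 < ell j) :
  (exists sigma, enumerates (qmult n alpha ell) sigma) /\
  (exists nu, enumerates (gmult n alpha ell) nu) /\
  (forall sigma nu : nat -> R,
     enumerates (qmult n alpha ell) sigma ->
     enumerates (gmult n alpha ell) nu ->
     forall m : nat, sigma m ^ 2 = nu m).
Proof.
  assert (Hal : forall j, (j < n)%nat -> 0 < alpha j) by (intros; now apply Halpha).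
  destruct (qmult_summary n alpha ell Hn Hal Hell) as [Z [HZ [Hfin Hinf]]].
  assert (Hqg : forall s k, 0 <= s -> qmult n alpha ell s k -> gmult n alpha ell (s ^ 2) k).
  { intros s k Hs Hk. destruct (HZ s Hs) as [k' [Hq [Hg _]]].
    now rewrite (qmult_unique _ _ _ _ _ _ Hk Hq). }
  assert (Hneg : forall s, s < 0 -> qmult n alpha ell s 0) by (intros; left; auto).
  assert (Hpos : forall sigma, enumerates (qmult n alpha ell) sigma -> forall m, 0 <= sigma m).
  { intros sigma [_ H] m. apply Rnot_lt_le; intros Hlt.
    destruct (H (sigma m)) as [k [Hc Hq]].
    rewrite (qmult_unique _ _ _ _ _ _ Hq (Hneg _ Hlt)) in Hc.
    now apply (count_all_zero _ Hc m). }
  (* Since every sigma m is nonnegative, squaring preserves the order and the indices with square y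
     >= 0 are those with value sqrt y. A negative y is no square and has no nonzero
     eigenfunction. *)
  assert (Hsq : forall sigma, enumerates (qmult n alpha ell) sigma ->
    enumerates (gmult n alpha ell) (fun m => sigma m ^ 2)).
  { intros sigma Hsig. assert (Hp := Hpos sigma Hsig). destruct Hsig as [Hmon Hc]. split.
    - intros m. apply pow_incr; auto.
    - intros y. destruct (Rlt_or_le y 0) as [Hy|Hy].
      + exists 0%nat. split.
        * exists []; repeat split; [constructor|easy|].
          intros E. pose proof (pow2_ge_0 (sigma m)). simpl in *; lra.
        * apply (gmult_basis n alpha ell y 0 (fun _ _ _ => 0)); try (intros; lia).
          intros f Hf. exists (fun _ => 0). intros j Hj x Hx; simpl.
          apply (eigfun_nonpos n alpha ell y f Hell ltac:(lra) Hf j Hj x Hx); auto.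
      + destruct (Hc (sqrt y)) as [k [Hk Hq]]. exists k; split.
        * eapply count_all_ext; [|exact Hk]. intros m; split.
          -- intros ->. now apply pow2_sqrt.
          -- intros <-. symmetry. now apply sqrt_pow2.
        * apply Hqg in Hq; [|apply sqrt_pos]. now rewrite pow2_sqrt in Hq. }
  assert (Hsigma : exists sigma, enumerates (qmult n alpha ell) sigma).
  { assert (Hex : forall y, exists k, qmult n alpha ell y k).
    { intros y. destruct (Rlt_or_le y 0) as [Hy|Hy]; [eauto|].
      destruct (HZ y Hy) as [k [Hk _]]; eauto. }
    set (mu y := proj1_sig (constructive_indefinite_description _ (Hex y))).
    assert (Hmu : forall y, qmult n alpha ell y (mu y))
      by (intros y; exact (proj2_sig (constructive_indefinite_description _ (Hex y)))).
    assert (HmuZ : forall y, 0 < y -> (mu y <> 0%nat <-> Z y)).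
    { intros y Hy. destruct (HZ y ltac:(lra)) as [k [Hq [_ Hk]]].
      now rewrite (qmult_unique _ _ _ _ _ _ (Hmu y) Hq), Hk. }
    apply (enumerates_exists _ mu Hmu).
    (* The value 0 is added by hand because Z describes quasi-eigenvalues only for s > 0. *)
    - intros L. destruct (Hfin L) as [l Hl]. exists (0 :: l). intros y Hy Hk.
      destruct (Rtotal_order y 0) as [H|[->|H]]; [|now left|right].
      + exfalso; apply Hk. exact (qmult_unique _ _ _ _ _ _ (Hmu y) (Hneg y H)).
      + apply Hl; [lra|]. now apply HmuZ.
    - intros L. destruct (Hinf (Rmax L 0)) as [s [Hs HZs]].
      pose proof (Rmax_l L 0); pose proof (Rmax_r L 0).
      exists s; split; [lra|]. apply HmuZ; auto; lra. }
  split; [auto|split].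
  - destruct Hsigma as [sigma Hs]; eauto.
  - intros sigma nu Hs Hnu. apply Hsq in Hs. destruct Hs as [H1 H2], Hnu as [H3 H4].
    apply (sorted_unique (fun m => sigma m ^ 2) nu); auto.
    intros v. destruct (H2 v) as [k [Hk Hg]], (H4 v) as [k' [Hk' Hg']].
    exists k; split; auto. now rewrite (gmult_unique _ _ _ _ _ _ Hg Hg').
Qed.
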